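(* The following is provable in $\mathrm{BZFC}$: for every set $A$, $$|A|=|A_{\mathbf t}|+|A_{\mathbf b}|\cdot\mathfrak b+|A_{\mathbf n}|\cdot\mathfrak n.$$
   Context: Logic. The background logic is the four-valued first-order logic BS4 with primitives $\sim,\land,\lor,\rightarrow,\leftrightarrow,\bot,\forall,\exists$. A model has a non-empty domain $M$, the usual interpretations of constants and function symbols, and, for each $n$-ary relation symbol $R$, two independent interpretations $R^+,R^-\subseteq M^n$; $=^+$ is true identity and $=^-$ is a symmetric relation. Truth and falsity are defined simultaneously (a formula may be true, false, both, or neither): an atomic formula is true/false according to $R^+$/$R^-$; $\sim\varphi$ is true iff $\varphi$ is false, and false iff $\varphi$ is true; $\varphi\land\psi$ is true iff both are true, false iff at least one is false; $\lor$ dually; $\varphi\rightarrow\psi$ is true iff ($\varphi$ true implies $\psi$ true), false iff $\varphi$ is true and $\psi$ is false; $\varphi\leftrightarrow\psi$ is true iff ($\varphi$ true iff $\psi$ true), false iff ($\varphi$ true and $\psi$ false) or ($\varphi$ false and $\psi$ true); $\forall$ is true iff all instances are true, false iff some instance is false; $\exists$ is true iff some instance is true, false iff all instances are false; $\bot$ is false and not true. $\Gamma\vDash\varphi$ iff $\varphi$ is true in every model in which all of $\Gamma$ is true. Asserting a formula means asserting that it is true; English ''iff'', ''if/then'', ''and'', ''or'' between formulas concern truth. Abbreviations: $\neg\varphi:=\varphi\rightarrow\bot$ (true iff $\varphi$ is not true); $!\varphi:=\sim\neg\varphi$ (two-valued, true iff $\varphi$ is true); $?\varphi:=\neg\sim\varphi$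 (two-valued, true iff $\varphi$ is not false); $\circ\varphi:=\,!\varphi\leftrightarrow ?\varphi$; $\varphi\Rightarrow\psi:=(\varphi\rightarrow\psi)\land(\sim\psi\rightarrow\sim\varphi)$; $\varphi\Leftrightarrow\psi:=(\varphi\leftrightarrow\psi)\land(\sim\varphi\leftrightarrow\sim\psi)$; $\varphi\,\&\,\psi:=\,\sim(\varphi\rightarrow\sim\psi)$; $\exists x\in A\,\varphi:=\exists x(x\in A\,\&\,\varphi)$; $\forall x\in A\,\varphi:=\forall x(x\in A\rightarrow\varphi)$. A slashed relation symbol is the $\sim$-negation of the relation. Set theory. $\mathrm{BZFC}$ is a BS4-theory in the language $\{\in,=\}$ whose objects are called sets. It includes: Extensionality $\forall A\forall B(A=B\Leftrightarrow\forall x(x\in A\Leftrightarrow x\in B))$; Comprehension $\forall A\exists B\forall x(x\in B\Leftrightarrow x\in A\land\varphi(x))$; ACLA: $\exists A(A^!\not\subseteq A^?)\land\exists A(A^?\not\subseteq A^!)$; Choice: every classical set of non-empty sets has a choice function. Here $A=\{x:\varphi(x)\}$ means $\forall x(x\in A\Leftrightarrow\varphi(x))$; $A\subseteq B:=\forall x(x\in A\Rightarrow x\in B)$; $A$ is classical if $\forall x\,{\circ}(x\in A)$; $A^!:=\{x:{!}(x\in A)\}$ and $A^?:=\{x:{?}(x\in A)\}$. The remaining axioms are suitable analogues of those of $\mathrm{ZFC}$; available consequences are: $A^!,A^?$ are (classical) sets; $A\subseteq B\leftrightarrow(A^!\subseteq B^!\land A^?\subseteq B^?)$, $A\not\subseteq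 B\leftrightarrow A^!\not\subseteq B^?$, $A=B\leftrightarrow(A^!=B^!\land A^?=B^?)$, $A\neq B\leftrightarrow(A^!\not\subseteq B^?\lor B^!\not\subseteq A^?)$; for all classical sets $X,Y$ there is a unique set $\langle X|Y\rangle$ with $\langle X|Y\rangle^!=X$, $\langle X|Y\rangle^?=Y$; ordered pairs (and triples) are encoded so that $(a,b)=(c,d)\Leftrightarrow(a=c\land b=d)$; usual $\mathrm{ZFC}$ set theory (including choice and von Neumann ordinals, which live in the inner $\mathrm{ZFC}$-model of hereditarily classical sets) applies to classical sets, whose elements may be arbitrary sets. For a classical set $X$, $|X|_{Cl}$ is the least von Neumann ordinal in bijection with $X$. Put $A_{\mathbf b}:=A^!\setminus A^?$, $A_{\mathbf t}:=A^!\cap A^?$, $A_{\mathbf n}:=A^?\setminus A^!$, $\mathrm{rlm}(A):=A^!\cup A^?$ (all classical sets). For pairwise disjoint classical $X,Y,Z$, $\langle X|Y|Z\rangle$ is the unique set $A$ with $A_{\mathbf b}=X$, $A_{\mathbf t}=Y$, $A_{\mathbf n}=Z$. $\emptyset=\{x:\bot\}$, and $\{a\}$ is the classical set $\{x:{!}(x=a)\}$. Cardinal numbers. The cardinal number of $A$ is the triple $|A|:=(X,Y,Z)$ with $$X:=\big\langle |A^!|_{Cl}\,\big|\,|A^?|_{Cl}\big\rangle,\quad Y:=\big\langle |A_{\mathbf t}|_{Cl}\,\big|\,|A^?|_{Cl}\big\rangle,\quad Z:=\big\langle |A_{\mathbf b}|_{Cl}\,\big|\,|A_{\mathbf n}|_{Cl}\big\rangle.$$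 Cardinal numbers are the elements of $\{|x|:x\text{ a set}\}$. Arithmetic: $|A|+|B|:=|A\uplus B|$ and $|A|\cdot|B|:=|A\times B|$, where $A\times B:=\{(x,y):x\in A\land y\in B\}$ (so $(a,b)\in A\times B\Leftrightarrow a\in A\land b\in B$) and $A\uplus B:=\{(x,0):x\in A\}\cup\{(x,1):x\in B\}$ (so $(a,0)\in A\uplus B\Leftrightarrow a\in A$ and $(b,1)\in A\uplus B\Leftrightarrow b\in B$). Finally $\mathfrak b:=|\langle\{\emptyset\}|\emptyset|\emptyset\rangle|$ and $\mathfrak n:=|\langle\emptyset|\emptyset|\{\emptyset\}\rangle|$. *)

(* Defs.v *)
From Stdlib Require Import Arith.

(** * The logic BS4 over the language {∈, =}: syntax with named variables *)

Inductive form : Type :=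
| Bot
| Mem (x y : nat)
| Eq (x y : nat)
| Neg (p : form)
| And (p q : form)
| Or (p q : form)
| Imp (p q : form)
| Iff (p q : form)
| All (x : nat) (p : form)
| Ex (x : nat) (p : form).

(** The positive interpretation of [=] is true identity, so only its negative
    interpretation is part of a model. *)
Record model : Type := Model {
  dom :> Type;
  dom_inhabited : inhabited dom;
  memT : dom -> dom -> Prop;
  memF : dom -> dom -> Prop;
  eqF : dom -> dom -> Prop;
  eqF_sym : forall a b, eqF a b -> eqF b a
}.

Definition upd {D : Type} (e : nat -> D) (x : nat) (a : D) : nat -> D :=
  fun y => if Nat.eqb y x then a else e y.

Fixpoint tr (M : model) (e : nat -> M) (p : form) {struct p} : Prop :=
  match p with
  | Bot => False
  | Mem x y => memT M (e x) (e y)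
  | Eq x y => e x = e y
  | Neg p => fa M e p
  | And p q => tr M e p /\ tr M e q
  | Or p q => tr M e p \/ tr M e q
  | Imp p q => tr M e p -> tr M e q
  | Iff p q => tr M e p <-> tr M e q
  | All x p => forall a : M, tr M (upd e x a) p
  | Ex x p => exists a : M, tr M (upd e x a) p
  end
with fa (M : model) (e : nat -> M) (p : form) {struct p} : Prop :=
  match p with
  | Bot => True
  | Mem x y => memF M (e x) (e y)
  | Eq x y => eqF M (e x) (e y)
  | Neg p => tr M e p
  | And p q => fa M e p \/ fa M e q
  | Or p q => fa M e p /\ fa M e q
  | Imp p q => tr M e p /\ fa M e q
  | Iff p q => (tr M e p /\ fa M e q) \/ (fa M e p /\ tr M e q)
  | All x p => exists a : M, fa M (upd e x a) p
  | Ex x p => forall a : M, fa M (upd e x a) p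
  end.

(** Free variables are read as universally quantified. *)
Definition valid_in (M : model) (p : form) : Prop :=
  forall e : nat -> M, tr M e p.

Definition entails (G : form -> Prop) (p : form) : Prop :=
  forall M : model, (forall g, G g -> valid_in M g) -> valid_in M p.

(** * Writing formulas with Rocq binders

    An [fm] is a formula waiting for a number [k] such that every variable
    [>= k] is unused; a quantifier takes [k] as its bound variable and passes
    [S k] on.  Hence no capture can occur as long as the free variables of an
    [fm] are [< k]. *)

Definition fm : Type := nat -> form.

Definition sentence (p : fm) : form := p 0.

(** A given formula used inside an [fm]; [k] must exceed all its variables. *)
Definition lift (p : form) : fm := fun _ => p.

Definition fBot : fm := fun _ => Bot.
Definition fMem (x y : nat) : fm := fun _ => Mem x y.
Definition fEq (x y : nat) : fm := fun _ => Eq x y.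
Definition fNeg (p : fm) : fm := fun k => Neg (p k).
Definition fAnd (p q : fm) : fm := fun k => And (p k) (q k).
Definition fOr (p q : fm) : fm := fun k => Or (p k) (q k).
Definition fImp (p q : fm) : fm := fun k => Imp (p k) (q k).
Definition fIff (p q : fm) : fm := fun k => Iff (p k) (q k).
Definition fAll (p : nat -> fm) : fm := fun k => All k (p k (S k)).
Definition fEx (p : nat -> fm) : fm := fun k => Ex k (p k (S k)).

(** Quantification over a variable of a [lift]ed formula. *)
Definition all_named (x : nat) (p : fm) : fm := fun k => All x (p k).
Definition ex_named (x : nat) (p : fm) : fm := fun k => Ex x (p k).

Declare Scope bs4_scope.
Delimit Scope bs4_scope with bs4.
Bind Scope bs4_scope with fm.
Open Scope bs4_scope.

Notation "⊥" := fBot : bs4_scope.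
Notation "x ∈ y" := (fMem x y) (at level 70, no associativity) : bs4_scope.
Notation "x ≐ y" := (fEq x y) (at level 70, no associativity) : bs4_scope.
Notation "~ p" := (fNeg p) : bs4_scope.
Notation "p ∧ q" := (fAnd p q) (at level 80, right associativity) : bs4_scope.
Notation "p ∨ q" := (fOr p q) (at level 85, right associativity) : bs4_scope.
Notation "p → q" := (fImp p q)
  (at level 99, q at level 200, right associativity) : bs4_scope.
Notation "p ↔ q" := (fIff p q) (at level 95, no associativity) : bs4_scope.
Notation "∀ x .. y , p" := (fAll (fun x => .. (fAll (fun y => p)) ..))
  (at level 200, x binder, y binder, right associativity) : bs4_scope.
Notation "∃ x .. y , p" := (fEx (fun x => .. (fEx (fun y => p)) ..))
  (at level 200, x binder, y binder, right associativity) : bs4_scope.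

Definition fNot (p : fm) : fm := p → ⊥.
Notation "¬ p" := (fNot p) (at level 75, right associativity) : bs4_scope.

(** [!p], [?p] and [∘p]. *)
Definition Bang (p : fm) : fm := ~ ¬ p.
Definition Quest (p : fm) : fm := ¬ ~ p.
Definition Circ (p : fm) : fm := Bang p ↔ Quest p.

Definition fSImp (p q : fm) : fm := (p → q) ∧ (~ q → ~ p).
Definition fSIff (p q : fm) : fm := (p ↔ q) ∧ (~ p ↔ ~ q).
Definition fAmp (p q : fm) : fm := ~ (p → ~ q).
Notation "p ⇒ q" := (fSImp p q)
  (at level 99, q at level 200, right associativity) : bs4_scope.
Notation "p ⇔ q" := (fSIff p q) (at level 95, no associativity) : bs4_scope.
Notation "p & q" := (fAmp p q) (at level 80, right associativity) : bs4_scope.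

Definition all_in (A : nat) (p : nat -> fm) : fm := ∀ x, x ∈ A → p x.
Definition ex_in (A : nat) (p : nat -> fm) : fm := ∃ x, x ∈ A & p x.
Notation "'∀∈' A x , p" := (all_in A (fun x => p))
  (at level 200, A at level 0, x name, right associativity) : bs4_scope.
Notation "'∃∈' A x , p" := (ex_in A (fun x => p))
  (at level 200, A at level 0, x name, right associativity) : bs4_scope.

(** * Terms

    A defined term [t] is represented by its graph: [t v] says that [v] is the
    value of [t].  Terms are eliminated by Russell's definite description:
    [desc t p] is true iff [t] has exactly one value and [p] is true of it. *)

Definition tm : Type := nat -> fm.

Definition desc (t : tm) (p : nat -> fm) : fm :=
  ∃ v, (∀ w, t w ↔ w ≐ v) ∧ p v.

Definition var (x : nat) : tm := fun v => v ≐ x.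
Definition on1 (f : nat -> tm) (t : tm) : tm :=
  fun v => desc t (fun x => f x v).
Definition on2 (f : nat -> nat -> tm) (s t : tm) : tm :=
  fun v => desc s (fun x => desc t (fun y => f x y v)).
Definition on3 (f : nat -> nat -> nat -> tm) (r s t : tm) : tm :=
  fun v => desc r (fun x => desc s (fun y => desc t (fun z => f x y z v))).

Definition tEq (s t : tm) : fm := desc s (fun x => desc t (fun y => x ≐ y)).
Definition tMem (s : tm) (A : nat) : fm := desc s (fun x => x ∈ A).

Definition setof (p : nat -> fm) : tm := fun v => ∀ x, x ∈ v ⇔ p x.
Notation "{{ x | p }}" := (setof (fun x => p))
  (at level 0, x name, p at level 200) : bs4_scope.

(** * Basic set-theoretic notions *)

Definition subset (A B : nat) : fm := ∀ x, x ∈ A ⇒ x ∈ B.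
Definition classical (A : nat) : fm := ∀ x, Circ (x ∈ A).

(** [A^!] and [A^?]. *)
Definition bang (A : nat) : tm := {{ x | Bang (x ∈ A) }}.
Definition quest (A : nat) : tm := {{ x | Quest (x ∈ A) }}.

Definition empty : tm := {{ _ | ⊥ }}.
Definition singleton (a : nat) : tm := {{ x | Bang (x ≐ a) }}.
Definition upair (a b : nat) : tm := {{ x | Bang (x ≐ a) ∨ Bang (x ≐ b) }}.
Definition succ (a : nat) : tm := {{ x | x ∈ a ∨ Bang (x ≐ a) }}.
Definition union (A B : nat) : tm := {{ x | x ∈ A ∨ x ∈ B }}.
Definition inter (A B : nat) : tm := {{ x | x ∈ A ∧ x ∈ B }}.
Definition diff (A B : nat) : tm := {{ x | x ∈ A ∧ ~ x ∈ B }}.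
Definition zero : tm := empty.
Definition one : tm := on1 singleton empty.

Definition nonempty (A : nat) : fm := desc empty (fun o => ~ A ≐ o).

(** [A_b], [A_t] and [A_n]. *)
Definition part_b (A : nat) : tm := on2 diff (bang A) (quest A).
Definition part_t (A : nat) : tm := on2 inter (bang A) (quest A).
Definition part_n (A : nat) : tm := on2 diff (quest A) (bang A).

(** [⟨X|Y⟩] and [⟨X|Y|Z⟩]. *)
Definition mix (X Y : nat) : tm := fun A => bang A X ∧ quest A Y.
Definition mix3 (X Y Z : nat) : tm :=
  fun A => part_b A X ∧ part_t A Y ∧ part_n A Z.

(** Ordered pairs.  Kuratowski pairs built from classical sets respect truth
    but not falsity of [=], so they only serve to tag elements:
    [(a,b) = {⟨0,u⟩ : u ∈ a} ∪ {⟨1,u⟩ : u ∈ b}].  Then [(a,b)^!] and [(a,b)^?]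
    are the tagged unions of [a^!, b^!] and of [a^?, b^?], which gives
    [(a,b) = (c,d) ⇔ a = c ∧ b = d]. *)
Definition kpair (u v : nat) : tm := on2 upair (singleton u) (upair u v).
Definition pair (a b : nat) : tm :=
  {{ z | (∃ u, Bang (on2 kpair zero (var u) z) ∧ u ∈ a)
       ∨ (∃ u, Bang (on2 kpair one (var u) z) ∧ u ∈ b) }}.
Definition triple (a b c : nat) : tm := on2 pair (pair a b) (var c).

(** The [Bang] on the equation [z = (x,y)] is what makes
    [(a,b) ∈ A × B ⇔ a ∈ A ∧ b ∈ B] hold also for pairs with [(a,b) ≠ (a,b)];
    similarly for the disjoint union. *)
Definition prod (A B : nat) : tm :=
  {{ z | ∃ x y, Bang (pair x y z) ∧ (x ∈ A ∧ y ∈ B) }}.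
Definition tagged (A i : nat) : tm :=
  {{ z | ∃ x, Bang (pair x i z) ∧ x ∈ A }}.
Definition dsum (A B : nat) : tm :=
  on2 union (on2 tagged (var A) zero) (on2 tagged (var B) one).

(** * Ordinals and cardinal numbers *)

(** A transitive classical set of classical sets is hereditarily classical. *)
Definition ordinal (a : nat) : fm :=
  classical a
  ∧ (∀∈ a x, classical x)
  ∧ (∀∈ a x, subset x a)
  ∧ (∀∈ a x, ∀∈ a y, x ∈ y ∨ x ≐ y ∨ y ∈ x)
  ∧ (∀ s, classical s ∧ subset s a ∧ nonempty s →
       ∃∈ s m, ∀∈ s x, ¬ x ∈ m).

(** [f] is a classical set of pairs which is the graph of a function. *)
Definition function_on (f X : nat) : fm :=
  classical f
  ∧ (∀∈ f z, ∃∈ X x, ∃ y, pair x y z)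
  ∧ (∀∈ X x, ∃ y, ∀ v, tMem (pair x v) f ↔ v ≐ y).

Definition bijection (f X Y : nat) : fm :=
  function_on f X
  ∧ (∀ x y, tMem (pair x y) f → y ∈ Y)
  ∧ (∀∈ Y y, ∃ x, ∀ u, tMem (pair u y) f ↔ u ≐ x).

Definition equinumerous (X Y : nat) : fm := ∃ f, bijection f X Y.

(** [|X|_Cl], for classical [X]. *)
Definition clcard (X : nat) : tm := fun a =>
  classical X ∧ ordinal a ∧ equinumerous X a
  ∧ (∀ b, ordinal b ∧ equinumerous X b → a ≐ b ∨ a ∈ b).

Definition card (A : nat) : tm :=
  on3 triple
    (on2 mix (on1 clcard (bang A)) (on1 clcard (quest A)))
    (on2 mix (on1 clcard (part_t A)) (on1 clcard (quest A)))
    (on2 mix (on1 clcard (part_b A)) (on1 clcard (part_n A))).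

(** Sum and product of cardinal numbers through arbitrary representatives:
    that the result does not depend on them is part of what [desc] requires
    wherever these terms are used. *)
Definition cadd (c d : nat) : tm :=
  fun e => ∃ A B, card A c ∧ card B d ∧ on1 card (dsum A B) e.
Definition cmul (c d : nat) : tm :=
  fun e => ∃ A B, card A c ∧ card B d ∧ on1 card (prod A B) e.

Definition frak_b : tm := on1 card (on3 mix3 (on1 singleton empty) empty empty).
Definition frak_n : tm := on1 card (on3 mix3 empty empty (on1 singleton empty)).

(** * The theory BZFC *)

Definition extensionality : fm := ∀ A B, A ≐ B ⇔ ∀ x, x ∈ A ⇔ x ∈ B.

Definition comprehension (p : form) (x : nat) : fm :=
  ∀ A, ∃ B, all_named x (x ∈ B ⇔ (x ∈ A ∧ lift p)).

Definition classical_superset : fm := ∀ A, ∃ C, classical C ∧ subset A C.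

(** The premise says that [p] is a partial function from [x] to [y]. *)
Definition replacement (p : form) (x y : nat) : fm :=
  all_named x (∃ u, all_named y (lift p → y ≐ u)) →
  ∀ A, ∃ B, all_named y (y ∈ B ⇔ ex_named x (x ∈ A ∧ Bang (lift p))).

(** As for singletons, the [Bang] in pairing and power set is essential: the
    sets whose equality to [a] (or inclusion in [A]) is merely not false form
    a proper class. *)
Definition pairing : fm := ∀ a b, ∃ C, upair a b C.

Definition power_set : fm := ∀ A, ∃ P, ∀ X, X ∈ P ⇔ Bang (subset X A).

Definition union_set : fm :=
  ∀ A, ∃ B, ∀ x, x ∈ B ⇔ ∃ y, y ∈ A ∧ x ∈ y.

Definition infinity : fm :=
  ∃ I, classical I ∧ tMem empty I ∧ (∀∈ I x, tMem (succ x) I).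

(** [y] is outside [x^! ∪ x^?]. *)
Definition foundation : fm :=
  ∀ A, classical A ∧ nonempty A →
    ∃∈ A x, ∀∈ A y, ¬ y ∈ x ∧ ¬ Quest (y ∈ x).

Definition choice : fm :=
  ∀ X, classical X ∧ (∀∈ X A, nonempty A) →
    ∃ f, function_on f X ∧ (∀∈ X A, ∃∈ A y, tMem (pair A y) f).

Definition acla : fm :=
  (∃ A, desc (bang A) (fun I => desc (quest A) (fun J => ~ subset I J)))
  ∧ (∃ A, desc (bang A) (fun I => desc (quest A) (fun J => ~ subset J I))).

(** All variables of the formula, free or bound, are [< k]. *)
Fixpoint vars_lt (k : nat) (p : form) : Prop :=
  match p with
  | Bot => True
  | Mem x y | Eq x y => x < k /\ y < k
  | Neg p => vars_lt k p
  | And p q | Or p q | Imp p q | Iff p q => vars_lt k p /\ vars_lt k q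
  | All x p | Ex x p => x < k /\ vars_lt k p
  end.

(** In the two schemas the formula may contain further free variables
    (parameters), while the set variables introduced by the axiom are [>= k]
    and thus do not occur in it. *)
Inductive BZFC : form -> Prop :=
| ax_extensionality : BZFC (sentence extensionality)
| ax_comprehension (p : form) (x k : nat) :
    vars_lt k p -> x < k -> BZFC (comprehension p x k)
| ax_classical_superset : BZFC (sentence classical_superset)
| ax_replacement (p : form) (x y k : nat) :
    vars_lt k p -> x < k -> y < k -> x <> y -> BZFC (replacement p x y k)
| ax_pairing : BZFC (sentence pairing)
| ax_power_set : BZFC (sentence power_set)
| ax_union : BZFC (sentence union_set)
| ax_infinity : BZFC (sentence infinity)
| ax_foundation : BZFC (sentence foundation)
| ax_choice : BZFC (sentence choice)
| ax_acla : BZFC (sentence acla).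

(* Main.v *)
(** In a model of BZFC, a bijection between the realms of [A] and [B] that
    preserves truth and falsity of membership exists iff [A_b], [A_t], [A_n] are
    equinumerous with [B_b], [B_t], [B_n], that is, iff [|A| = |B|].  Such
    bijections carry over to disjoint sums and products, so sums and products
    of cardinal numbers do not depend on representatives; and [x ∈ A_b],
    [x ∈ A_n] correspond to [(x,∅)] in [A_b × ⟨{∅}|∅|∅⟩] and
    [A_n × ⟨∅|∅|{∅}⟩], which are a glut and a gap there.

    That [|A|] exists at all rests on the numeration theorem for classical sets
    with arbitrary elements.  A transfinite recursion along the ordinals of the
    model picks new elements of [X] by a choice function; as the elements of
    [X] determine the ordinals at which they are picked, replacement makes the
    recursion stop at some ordinal, and [X] is then exhausted. *)

From Stdlib Require Import Arith Lia Classical ClassicalEpsilon.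
From Stdlib Require Import FunctionalExtensionality.
Require Import Defs.
Close Scope bs4_scope.

(* The argument takes place inside an arbitrary model [M] of BZFC, with classical logic outside.
   Comprehension and Replacement speak only about formulas, so every predicate fed to them,
   including the approximations of the transfinite recursion and the graphs of bijections, must be
   definable with parameters. [Dfn] records this semantically and [dfn] proves it along the syntax
   of a Rocq proposition, so that almost no object formula is written by hand. A set carries two
   independent conditions, [tin] (membership is true) and [qin] (membership is not false). To
   prescribe both at once, a single formula needs unrelated truth and falsity conditions; such
   formulas can be built because ACLA supplies one glut and one gap as parameters. The statement
   itself is a formula whose terms are descriptions, true only if each term has exactly one value.
   Hence every term is matched with an operation on [M] through [denotes] and [graph1] to [graph3];
   once this is done, the theorem is an identity between elements of [M]. *)
Create HintDb definability.

(** * Renaming of variables *)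

(** Bound variables are renamed together with the free ones. For injective [s] this rules out
    capture, so no substitution machinery is required. *)
Fixpoint ren (s : nat -> nat) (p : form) : form :=
  match p with
  | Bot => Bot
  | Mem x y => Mem (s x) (s y)
  | Eq x y => Eq (s x) (s y)
  | Neg p => Neg (ren s p)
  | And p q => And (ren s p) (ren s q)
  | Or p q => Or (ren s p) (ren s q)
  | Imp p q => Imp (ren s p) (ren s q)
  | Iff p q => Iff (ren s p) (ren s q)
  | All x p => All (s x) (ren s p)
  | Ex x p => Ex (s x) (ren s p)
  end.

Lemma upd_same {D : Type} (e : nat -> D) x a : upd e x a x = a.
Proof. unfold upd. now rewrite Nat.eqb_refl. Qed.

Lemma upd_other {D : Type} (e : nat -> D) x y a : x <> y -> upd e x a y = e y.
Proof. intros H. unfold upd. destruct (Nat.eqb_spec y x); congruence. Qed.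

Lemma upd_lt {D : Type} (e : nat -> D) x y a : y < x -> upd e x a y = e y.
Proof. intros H. apply upd_other. lia. Qed.

Lemma vars_lt_mono p k l : k <= l -> vars_lt k p -> vars_lt l p.
Proof. induction p; simpl; intuition lia. Qed.

Lemma vars_lt_bound p : exists k, vars_lt k p.
Proof.
  induction p as [|x y|x y|p [k IH]|p [k IH] q [l IH']|p [k IH] q [l IH']
    |p [k IH] q [l IH']|p [k IH] q [l IH']|x p [k IH]|x p [k IH]]; simpl.
  - now exists 0.
  - exists (S (x + y)). lia.
  - exists (S (x + y)). lia.
  - now exists k.
  - exists (k + l). split; (eapply vars_lt_mono; [|eassumption]; lia).
  - exists (k + l). split; (eapply vars_lt_mono; [|eassumption]; lia).
  - exists (k + l). split; (eapply vars_lt_mono; [|eassumption]; lia).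
  - exists (k + l). split; (eapply vars_lt_mono; [|eassumption]; lia).
  - exists (S (x + k)). split; [lia|]. (eapply vars_lt_mono; [|eassumption]; lia).
  - exists (S (x + k)). split; [lia|]. (eapply vars_lt_mono; [|eassumption]; lia).
Qed.

Section Universe.
Variable M : model.
Implicit Types e : nat -> M.

(** Truth and falsity are treated together because [Neg] exchanges them. Injectivity makes an update
    at [s x] invisible at every other [s i], which is the equation [U]. *)
Lemma tr_fa_ren s (Hs : forall i j, s i = s j -> i = j) p :
  forall e, (tr M e (ren s p) <-> tr M (fun i => e (s i)) p)
         /\ (fa M e (ren s p) <-> fa M (fun i => e (s i)) p).
Proof.
  assert (U : forall e x a,
    (fun i => upd e (s x) a (s i)) = upd (fun i => e (s i)) x a).
  { intros e x a. apply functional_extensionality. intros i.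
    destruct (Nat.eq_dec x i) as [->|N].
    - now rewrite !upd_same.
    - rewrite !upd_other; auto. }
  induction p; simpl; intros e; try tauto.
  - destruct (IHp e). tauto.
  - destruct (IHp1 e), (IHp2 e). tauto.
  - destruct (IHp1 e), (IHp2 e). tauto.
  - destruct (IHp1 e), (IHp2 e). tauto.
  - destruct (IHp1 e), (IHp2 e). tauto.
  - split; [split; intros H a|split; intros [a H]; exists a];
      specialize (IHp (upd e (s x) a)); rewrite U in IHp; firstorder.
  - split; [split; intros [a H]; exists a|split; intros H a];
      specialize (IHp (upd e (s x) a)); rewrite U in IHp; firstorder.
Qed.

Lemma tr_fa_vars p : forall k e e',
  (forall i, i < k -> e i = e' i) -> vars_lt k p ->
  (tr M e p <-> tr M e' p) /\ (fa M e p <-> fa M e' p).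
Proof.
  assert (U : forall k e e' x a, (forall i, i < k -> e i = e' i) ->
    forall i, i < k -> upd e x a i = upd e' x a i).
  { intros k e e' x a H i Hi. unfold upd. destruct (Nat.eqb i x); auto. }
  induction p; simpl; intros k e e' H V; try tauto.
  - rewrite !(H x), !(H y) by tauto. tauto.
  - rewrite !(H x), !(H y) by tauto. tauto.
  - destruct (IHp k e e'); tauto.
  - destruct (IHp1 k e e'), (IHp2 k e e'); tauto.
  - destruct (IHp1 k e e'), (IHp2 k e e'); tauto.
  - destruct (IHp1 k e e'), (IHp2 k e e'); tauto.
  - destruct (IHp1 k e e'), (IHp2 k e e'); tauto.
  - destruct V as [_ V].
    split; [split; intros G a|split; intros [a G]; exists a];
      destruct (IHp k (upd e x a) (upd e' x a)); auto; firstorder.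
  - destruct V as [_ V].
    split; [split; intros [a G]; exists a|split; intros G a];
      destruct (IHp k (upd e x a) (upd e' x a)); auto; firstorder.
Qed.

(** * Definability with parameters *)

(** Variables below [k] hold parameters, the others hold the arguments. *)
Definition with_params (k : nat) (par e : nat -> M) : nat -> M :=
  fun i => if i <? k then par i else e (i - k).

(** [P] and [Q] are the truth and the falsity condition of a formula with
    parameters. *)
Definition defines (P Q : (nat -> M) -> Prop) : Prop :=
  exists p k par, forall e,
    (tr M (with_params k par e) p <-> P e)
    /\ (fa M (with_params k par e) p <-> Q e).

(** Two-valued definability, the notion closed under all classical connectives. Any formula can be
    brought to this form by [Dfn_truth], at the price of forgetting its falsity condition. *)
Definition Dfn (P : (nat -> M) -> Prop) : Prop := defines P (fun e => ~ P e).

Definition cons (a : M) e : nat -> M :=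
  fun i => match i with 0 => a | S i => e i end.

Lemma defines_ext P Q P' Q' :
  (forall e, P e <-> P' e) -> (forall e, Q e <-> Q' e) ->
  defines P Q -> defines P' Q'.
Proof.
  intros HP HQ (p & k & par & H). exists p, k, par. intros e.
  rewrite <- HP, <- HQ. apply H.
Qed.

Lemma Dfn_ext P P' : (forall e, P e <-> P' e) -> Dfn P -> Dfn P'.
Proof.
  intros H. apply defines_ext; auto. intros e. now rewrite H.
Qed.

Lemma defines_common P Q P' Q' :
  defines P Q -> defines P' Q' ->
  exists p p' k par, forall e,
    (tr M (with_params k par e) p <-> P e)
    /\ (fa M (with_params k par e) p <-> Q e)
    /\ (tr M (with_params k par e) p' <-> P' e)
    /\ (fa M (with_params k par e) p' <-> Q' e).
Proof.
  intros (p & k & par & H) (p' & k' & par' & H').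
  (* Both parameter blocks are placed side by side: the first formula keeps its parameters and moves
     its arguments up by [k'], the second moves everything up by [k]. *)
  set (s := fun i => if i <? k then i else i + k').
  set (s' := fun i => i + k).
  set (par2 := fun i => if i <? k then par i else par' (i - k)).
  exists (ren s p), (ren s' p'), (k + k'), par2. intros e.
  destruct (tr_fa_ren s) with (p := p) (e := with_params (k + k') par2 e)
    as [A B].
  { intros i j. unfold s.
    destruct (Nat.ltb_spec i k), (Nat.ltb_spec j k); lia. }
  destruct (tr_fa_ren s') with (p := p') (e := with_params (k + k') par2 e)
    as [A' B'].
  { unfold s'. lia. }
  replace (fun i => with_params (k + k') par2 e (s i)) with
    (with_params k par e) in A, B.
  2:{ apply functional_extensionality. intros i. unfold with_params, s, par2.
      destruct (Nat.ltb_spec i k).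
      - destruct (Nat.ltb_spec i (k + k')); try lia.
        destruct (Nat.ltb_spec i k); try lia. reflexivity.
      - destruct (Nat.ltb_spec (i + k') (k + k')); try lia. f_equal. lia. }
  replace (fun i => with_params (k + k') par2 e (s' i)) with
    (with_params k' par' e) in A', B'.
  2:{ apply functional_extensionality. intros i. unfold with_params, s', par2.
      destruct (Nat.ltb_spec i k'), (Nat.ltb_spec (i + k) (k + k')); try lia.
      - destruct (Nat.ltb_spec (i + k) k); try lia. f_equal. lia.
      - f_equal. lia. }
  specialize (H e). specialize (H' e). tauto.
Qed.

Lemma defines_and P Q P' Q' : defines P Q -> defines P' Q' ->
  defines (fun e => P e /\ P' e) (fun e => Q e \/ Q' e).
Proof.
  intros H H'. destruct (defines_common _ _ _ _ H H') as (p & p' & k & par & G).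
  exists (And p p'), k, par. intros e. specialize (G e). simpl. tauto.
Qed.

Lemma defines_or P Q P' Q' : defines P Q -> defines P' Q' ->
  defines (fun e => P e \/ P' e) (fun e => Q e /\ Q' e).
Proof.
  intros H H'. destruct (defines_common _ _ _ _ H H') as (p & p' & k & par & G).
  exists (Or p p'), k, par. intros e. specialize (G e). simpl. tauto.
Qed.

(** The formula is [!p], which is two-valued and true iff [p] is. *)
Lemma Dfn_truth P Q : defines P Q -> Dfn P.
Proof.
  intros (p & k & par & H). exists (Neg (Imp p Bot)), k, par.
  intros e. specialize (H e). simpl. tauto.
Qed.

Lemma Dfn_and P Q : Dfn P -> Dfn Q -> Dfn (fun e => P e /\ Q e).
Proof. intros H H'. eapply Dfn_truth, defines_and; eassumption. Qed.

Lemma Dfn_or P Q : Dfn P -> Dfn Q -> Dfn (fun e => P e \/ Q e).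
Proof. intros H H'. eapply Dfn_truth, defines_or; eassumption. Qed.

Lemma Dfn_imp P Q : Dfn P -> Dfn Q -> Dfn (fun e => P e -> Q e).
Proof.
  intros H H'. destruct (defines_common _ _ _ _ H H') as (p & p' & k & par & G).
  exists (Imp p p'), k, par. intros e. specialize (G e). simpl. tauto.
Qed.

Lemma Dfn_iff P Q : Dfn P -> Dfn Q -> Dfn (fun e => P e <-> Q e).
Proof. intros. apply Dfn_and; apply Dfn_imp; assumption. Qed.

Lemma Dfn_prop (P : Prop) : Dfn (fun _ => P).
Proof.
  destruct (dom_inhabited M) as [a].
  destruct (classic P).
  - exists (Neg Bot), 0, (fun _ => a). simpl. tauto.
  - exists Bot, 0, (fun _ => a). simpl. tauto.
Qed.

Lemma Dfn_not P : Dfn P -> Dfn (fun e => ~ P e).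
Proof. intros H. apply Dfn_imp; [exact H|apply Dfn_prop]. Qed.

Lemma Dfn_ex (R : M -> (nat -> M) -> Prop) :
  Dfn (fun e => R (e 0) (fun i => e (S i))) -> Dfn (fun e => exists a, R a e).
Proof.
  intros (p & k & par & H).
  (* Variable [k] is the first argument of [p]. Counting it as one more parameter shifts the other
     arguments down by one, and the quantifier overwrites its dummy value [par k]. The falsity
     condition can stay unevaluated, since [Dfn_truth] discards it. *)
  apply Dfn_truth with
    (Q := fun e => fa M (with_params (S k) par e) (Ex k p)).
  exists (Ex k p), (S k), par. intros e.
  assert (U : forall a,
    upd (with_params (S k) par e) k a = with_params k par (cons a e)).
  { intros a. apply functional_extensionality. intros i.
    destruct (Nat.eq_dec k i) as [->|N].
    - rewrite upd_same. unfold with_params.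
      rewrite Nat.ltb_irrefl, Nat.sub_diag. reflexivity.
    - rewrite upd_other by exact N. unfold with_params.
      destruct (Nat.ltb_spec i (S k)), (Nat.ltb_spec i k); try lia.
      + reflexivity.
      + replace (i - k) with (S (i - S k)) by lia. reflexivity. }
  split; [|reflexivity].
  simpl. split; intros [a G]; exists a.
  - rewrite U in G. now apply (H (cons a e)) in G.
  - rewrite U. now apply (H (cons a e)).
Qed.

Lemma Dfn_all (R : M -> (nat -> M) -> Prop) :
  Dfn (fun e => R (e 0) (fun i => e (S i))) -> Dfn (fun e => forall a, R a e).
Proof.
  intros H.
  apply Dfn_ext with (P := fun e => ~ exists a, ~ R a e).
  - intros e. split.
    + intros G a. apply NNPP. intros N. apply G. now exists a.
    + intros G [a N]. auto.
  - apply Dfn_not, Dfn_ex, Dfn_not, H.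
Qed.

Lemma Dfn_ren s (Hs : forall i j, s i = s j -> i = j) P :
  Dfn P -> Dfn (fun e => P (fun i => e (s i))).
Proof.
  intros (p & k & par & H).
  set (s' := fun i => if i <? k then i else k + s (i - k)).
  exists (ren s' p), k, par. intros e.
  destruct (tr_fa_ren s') with (p := p) (e := with_params k par e) as [A B].
  { intros i j. unfold s'.
    destruct (Nat.ltb_spec i k), (Nat.ltb_spec j k); try lia.
    intros G. assert (s (i - k) = s (j - k)) as G' by lia.
    apply Hs in G'. lia. }
  replace (fun i => with_params k par e (s' i)) with
    (with_params k par (fun i => e (s i))) in A, B.
  2:{ apply functional_extensionality. intros i. unfold with_params, s'.
      destruct (Nat.ltb_spec i k).
      - destruct (Nat.ltb_spec i k); try lia. reflexivity.
      - destruct (Nat.ltb_spec (k + s (i - k)) k); try lia. f_equal. lia. }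
  specialize (H (fun i => e (s i))). tauto.
Qed.

Lemma Dfn_atom_In i j : Dfn (fun e => memT M (e i) (e j)).
Proof.
  destruct (dom_inhabited M) as [a].
  apply Dfn_truth with (Q := fun e => memF M (e i) (e j)).
  exists (Mem i j), 0, (fun _ => a). intros e.
  simpl. unfold with_params. simpl. rewrite !Nat.sub_0_r.
  split; reflexivity.
Qed.

Lemma Dfn_atom_memF i j : Dfn (fun e => memF M (e i) (e j)).
Proof.
  destruct (dom_inhabited M) as [a].
  apply Dfn_truth with (Q := fun e => memT M (e i) (e j)).
  exists (Neg (Mem i j)), 0, (fun _ => a). intros e.
  simpl. unfold with_params. simpl. rewrite !Nat.sub_0_r.
  split; reflexivity.
Qed.

Lemma Dfn_atom_eq i j : Dfn (fun e => e i = e j).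
Proof.
  destruct (dom_inhabited M) as [a].
  apply Dfn_truth with (Q := fun e => eqF M (e i) (e j)).
  exists (Eq i j), 0, (fun _ => a). intros e.
  simpl. unfold with_params. simpl. rewrite !Nat.sub_0_r.
  split; reflexivity.
Qed.

Lemma Dfn_atom_const i c : Dfn (fun e => e i = c).
Proof.
  apply Dfn_truth with (Q := fun e => eqF M (e i) c).
  exists (Eq (S i) 0), 1, (fun _ => c). intros e.
  simpl. unfold with_params. simpl. rewrite Nat.sub_0_r.
  split; reflexivity.
Qed.

(** In [Dfn_ex] and here variables are shifted as in de Bruijn notation:
    variable [0] is the new one. *)
Definition DfnT (t : (nat -> M) -> M) : Prop :=
  Dfn (fun e => e 0 = t (fun i => e (S i))).

Lemma DfnT_var i : DfnT (fun e => e i).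
Proof. exact (Dfn_atom_eq 0 (S i)). Qed.

Lemma DfnT_const c : DfnT (fun _ => c).
Proof. exact (Dfn_atom_const 0 c). Qed.

Lemma DfnT_shift t : DfnT t -> DfnT (fun e => t (fun i => e (S i))).
Proof.
  intros H.
  apply (Dfn_ren (fun i => match i with 0 => 0 | S i => S (S i) end)) in H.
  - exact H.
  - intros [|i] [|j]; lia.
Qed.

Lemma Dfn_let t (R : M -> (nat -> M) -> Prop) :
  DfnT t -> Dfn (fun e => R (e 0) (fun i => e (S i))) -> Dfn (fun e => R (t e) e).
Proof.
  intros Ht H.
  apply Dfn_ext with (P := fun e => exists a, a = t e /\ R a e).
  - intros e. split.
    + intros (a & -> & G). exact G.
    + intros G. now exists (t e).
  - apply (Dfn_ex (fun a e => a = t e /\ R a e)), Dfn_and; assumption.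
Qed.

Definition Dfn1 (P : M -> Prop) : Prop := Dfn (fun e => P (e 0)).
Definition Dfn2 (R : M -> M -> Prop) : Prop := Dfn (fun e => R (e 0) (e 1)).
Definition DfnF1 (F : M -> M) : Prop := DfnT (fun e => F (e 0)).
Definition DfnF2 (F : M -> M -> M) : Prop := DfnT (fun e => F (e 0) (e 1)).

Lemma Dfn1_app P t : Dfn1 P -> DfnT t -> Dfn (fun e => P (t e)).
Proof. intros H Ht. exact (Dfn_let t (fun a e => P a) Ht H). Qed.

Lemma Dfn2_app R s t : Dfn2 R -> DfnT s -> DfnT t -> Dfn (fun e => R (s e) (t e)).
Proof.
  intros H Hs Ht.
  apply (Dfn_let t (fun b e => R (s e) b)); [exact Ht|].
  apply (Dfn_let (fun e => s (fun i => e (S i))) (fun a e => R a (e 0))).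
  - now apply DfnT_shift.
  - exact H.
Qed.

Lemma DfnF1_app F t : DfnF1 F -> DfnT t -> DfnT (fun e => F (t e)).
Proof.
  intros H Ht.
  apply (Dfn_let (fun e => t (fun i => e (S i))) (fun a e => e 0 = F a)).
  - now apply DfnT_shift.
  (* In [H] the value is variable 0 and the argument variable 1; after [Dfn_let] it is the other way
     round. *)
  - apply (Dfn_ren (fun i => match i with 0 => 1 | 1 => 0 | S i => S i end)) in H.
    + exact H.
    + intros [|[|i]] [|[|j]]; lia.
Qed.

Lemma DfnF2_app F s t : DfnF2 F -> DfnT s -> DfnT t -> DfnT (fun e => F (s e) (t e)).
Proof.
  intros H Hs Ht.
  apply (Dfn_let (fun e => t (fun i => e (S i)))
    (fun b e => e 0 = F (s (fun i => e (S i))) b)).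
  { now apply DfnT_shift. }
  apply (Dfn_let (fun e => s (fun i => e (S (S i)))) (fun a e => e 1 = F a (e 0))).
  { apply (DfnT_shift (fun e => s (fun i => e (S i)))). now apply DfnT_shift. }
  apply (Dfn_ren (fun i => match i with 0 => 2 | 1 => 0 | 2 => 1 | S i => S i end)) in H.
  - exact H.
  - intros [|[|[|i]]] [|[|[|j]]]; lia.
Qed.

(** * Sets of a model of BZFC *)

Hypothesis HM : forall g, BZFC g -> valid_in M g.
Implicit Types A B C X Y a b c d x y z : M.

(** Membership is true, resp. not false: [x ∈ A^!] and [x ∈ A^?]. *)
Definition tin x A : Prop := memT M x A.
Definition qin x A : Prop := ~ memF M x A.

Lemma memF_qin x A : memF M x A <-> ~ qin x A.
Proof. unfold qin. split; [tauto|apply NNPP]. Qed.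

Lemma set_ext A B :
  (forall x, tin x A <-> tin x B) -> (forall x, qin x A <-> qin x B) -> A = B.
Proof.
  intros H H'.
  pose proof (HM _ ax_extensionality (fun _ => A) A B) as [E _]. cbn in E.
  apply E. intros x. split; [apply H|].
  specialize (H' x). unfold qin in H'. tauto.
Qed.

Lemma Dfn_tin : Dfn2 tin.
Proof. exact (Dfn_atom_In 0 1). Qed.

Lemma Dfn_qin : Dfn2 qin.
Proof. exact (Dfn_not _ (Dfn_atom_memF 0 1)). Qed.

Lemma glut_exists : exists x A, tin x A /\ ~ qin x A.
Proof.
  destruct (dom_inhabited M) as [d].
  destruct (HM _ ax_acla (fun _ => d)) as [H _]. cbn in H.
  destruct H as (A & I & HI & J & HJ & x & H).
  pose proof (proj2 (HI I) eq_refl x) as [K1 K2].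
  pose proof (proj2 (HJ J) eq_refl x) as [K3 K4].
  exists x, A. unfold tin, qin. tauto.
Qed.

Lemma gap_exists : exists x A, ~ tin x A /\ qin x A.
Proof.
  destruct (dom_inhabited M) as [d].
  destruct (HM _ ax_acla (fun _ => d)) as [_ H]. cbn in H.
  destruct H as (A & I & HI & J & HJ & x & H).
  pose proof (proj2 (HI I) eq_refl x) as [K1 K2].
  pose proof (proj2 (HJ J) eq_refl x) as [K3 K4].
  exists x, A. unfold tin, qin. tauto.
Qed.

Lemma defines_membership x A :
  defines (fun _ : nat -> M => tin x A) (fun _ => ~ qin x A).
Proof.
  exists (Mem 0 1), 2, (fun i => match i with 0 => x | _ => A end).
  intros e. cbn. split; [reflexivity|apply memF_qin].
Qed.

(** A glut and a gap make truth and falsity of a formula independent. *)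
Lemma defines_mixed (P Q : (nat -> M) -> Prop) :
  Dfn P -> Dfn Q -> defines P (fun e => ~ Q e).
Proof.
  intros HP HQ.
  destruct glut_exists as (x & A & H1 & H2), gap_exists as (y & B & H3 & H4).
  (* The formula is [(P ∧ Q) ∨ (P ∧ glut) ∨ (Q ∧ gap)]. For truth, the glut is true and the gap is
     not, which leaves [P]. For falsity, the glut is false, so the second disjunct always is, and
     the gap is not false, so the third is false iff [Q] fails; this leaves the negation of [Q]. *)
  apply (defines_ext
    (fun e => P e /\ Q e \/ (P e /\ tin x A) \/ (Q e /\ tin y B))
    (fun e => (~ P e \/ ~ Q e) /\ (~ P e \/ ~ qin x A) /\ (~ Q e \/ ~ qin y B))).
  - tauto.
  - tauto.
  - repeat first [apply defines_or | apply defines_and];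
      assumption || apply defines_membership.
Qed.

(** Prepares the axiom schemas: they need a bound [l] above all variables of the formula, so that
    their own set variables [l] and [S l] are fresh. The condition [k + 2 <= l] leaves room for two
    arguments at [k] and [S k]. *)
Lemma formula_in_variables (P Q : (nat -> M) -> Prop) : defines P Q ->
  exists p k l (e0 : nat -> M), vars_lt l p /\ k + 2 <= l /\
    forall E e, (forall i, i < k -> E i = e0 i) ->
      (forall i, k <= i -> i < l -> E i = e (i - k)) ->
      (tr M E p <-> P e) /\ (fa M E p <-> Q e).
Proof.
  intros (p & k & par & H). destruct (vars_lt_bound p) as [l Hl].
  exists p, k, (l + k + 2), par. split; [|split; [lia|]].
  { eapply vars_lt_mono; [|exact Hl]. lia. }
  intros E e H0 H1.
  destruct (tr_fa_vars p l E (with_params k par e)) as [A B].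
  { intros i Hi. unfold with_params. destruct (Nat.ltb_spec i k).
    - now apply H0.
    - apply H1; lia. }
  { exact Hl. }
  specialize (H e). tauto.
Qed.

Lemma comprehension_mixed (P Q : M -> Prop) A : Dfn1 P -> Dfn1 Q ->
  exists B, forall x,
    (tin x B <-> tin x A /\ P x) /\ (qin x B <-> qin x A /\ Q x).
Proof.
  intros HP HQ.
  destruct (formula_in_variables _ _ (defines_mixed _ _ HP HQ))
    as (p & k & l & e0 & V & L & H).
  (* Parameters go below [k]; elsewhere [A] is a default value. The axiom then binds its sets at [l]
     and [S l] and its element at [k]. *)
  set (e1 := fun i => if i <? k then e0 i else A).
  set (E := fun B x => upd (upd (upd e1 l A) (S l) B) k x).
  assert (HB : exists B, forall x,
    (memT M (E B x k) (E B x (S l)) <->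
      memT M (E B x k) (E B x l) /\ tr M (E B x) p) /\
    (memF M (E B x k) (E B x (S l)) <->
      memF M (E B x k) (E B x l) \/ fa M (E B x) p))
    by exact (HM _ (ax_comprehension p k l V ltac:(lia)) e1 A).
  destruct HB as [B HB]. exists B. intros x. specialize (HB x).
  assert (E1 : E B x k = x) by apply upd_same.
  assert (E2 : E B x (S l) = B)
    by (unfold E; now rewrite (upd_other _ k), upd_same by lia).
  assert (E3 : E B x l = A)
    by (unfold E; now rewrite !upd_other, upd_same by lia).
  rewrite E1, E2, E3 in HB.
  (* Only argument 0 matters to [P] and [Q]; the others repeat what [E B x] has between [k] and
     [l]. *)
  destruct (H (E B x) (fun i => match i with 0 => x | _ => e1 (i + k) end))
    as [H1 H2].
  - intros i Hi. unfold E, e1. rewrite !upd_other by lia.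
    destruct (Nat.ltb_spec i k); [reflexivity|lia].
  - intros i Hi Hi'. unfold E. destruct (Nat.eq_dec k i) as [->|N].
    + now rewrite upd_same, Nat.sub_diag.
    + rewrite !upd_other by lia.
      destruct (i - k) eqn:?; [lia|]. f_equal. lia.
  - unfold tin, qin. tauto.
Qed.

Lemma replacement_sem (R : M -> M -> Prop) A : Dfn2 R ->
  (forall x y y', R x y -> R x y' -> y = y') ->
  exists B, forall y, tin y B <-> exists x, tin x A /\ R x y.
Proof.
  intros HR F.
  destruct (formula_in_variables _ _ HR) as (p & k & l & e0 & V & L & H).
  assert (G : forall e x y, (forall i, i < k -> e i = e0 i) ->
    e k = x -> e (S k) = y ->
    (tr M e p <-> R x y)).
  { intros e x y H1 H2 H3.
    destruct (H e (fun i => e (i + k))) as [T _].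
    - exact H1.
    - intros i Hi Hi'. f_equal. lia.
    - rewrite T. cbn. now rewrite H2, H3. }
  set (e1 := fun i => if i <? k then e0 i else A).
  assert (E1 : forall i, i < k -> e1 i = e0 i).
  { intros i Hi. unfold e1. destruct (Nat.ltb_spec i k); [reflexivity|lia]. }
  assert (G' : forall a b x y,
    tr M (upd (upd (upd (upd e1 l a) (S l) b) (S k) y) k x) p <-> R x y).
  { intros a b x y. apply G.
    - intros i Hi. rewrite !upd_other by lia. auto.
    - apply upd_same.
    - rewrite (upd_other _ k (S k)), upd_same by lia. reflexivity. }
  (* This is the truth condition of the Replacement instance, with its functionality premise first;
     it agrees with the axiom by computation. *)
  assert (HB : (forall x, exists u, forall y,
      tr M (upd (upd (upd e1 k x) l u) (S k) y) p ->
      upd (upd (upd e1 k x) l u) (S k) y (S k) =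
      upd (upd (upd e1 k x) l u) (S k) y l) ->
    forall a, exists b, forall y,
      let E := upd (upd (upd e1 l a) (S l) b) (S k) y in
      (memT M (E (S k)) (E (S l)) <->
        exists x, memT M (upd E k x k) (upd E k x l) /\
          (tr M (upd E k x) p /\ True))
      /\ (memF M (E (S k)) (E (S l)) <-> forall x,
        memF M (upd E k x k) (upd E k x l) \/ (tr M (upd E k x) p -> False)))
    by exact (HM _ (ax_replacement p k (S k) l V ltac:(lia) ltac:(lia)
      ltac:(lia)) e1).
  destruct HB with (a := A) as [B HB'].
  - assert (K : forall u x y,
      tr M (upd (upd (upd e1 k x) l u) (S k) y) p <-> R x y).
    { intros u x y. apply G.
      - intros i Hi. rewrite !upd_other by lia. auto.
      - rewrite !(upd_other _ (S k) k), (upd_other _ l k), upd_same by lia.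
        reflexivity.
      - apply upd_same. }
    intros x. destruct (classic (exists u, R x u)) as [[u Hu]|N].
    + exists u. intros y Hy. rewrite upd_same.
      rewrite (upd_other _ (S k) l), upd_same by lia.
      apply (F x); [|exact Hu]. now apply K in Hy.
    (* Without a value at [x] the premise holds vacuously for any [u], so [x] serves as a
       default. *)
    + exists x. intros y Hy. destruct N. exists y. now apply K in Hy.
  - exists B. intros y. destruct (HB' y) as [T _].
    rewrite upd_same, (upd_other _ (S k) (S l)), upd_same in T by lia.
    unfold tin. rewrite T.
    split; intros [x Hx]; exists x; specialize (G' A B x y);
      rewrite upd_same, !(upd_other _ k l), !(upd_other _ (S k) l),
        !(upd_other _ (S l) l), upd_same in * by lia; tauto.
Qed.

Lemma Dfn_eq : Dfn2 (@eq (dom M)).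
Proof. exact (Dfn_atom_eq 0 1). Qed.

Hint Resolve Dfn_tin Dfn_qin Dfn_eq : definability.

(** Syntax-directed proofs of definability; definitions that are not in the
    hint database are unfolded. *)
Ltac dfn :=
  cbv beta;
  lazymatch goal with
  | |- Dfn (fun _ => ?P) => apply (Dfn_prop P)
  | |- Dfn (fun e => _ <-> _) => apply Dfn_iff; dfn
  | |- Dfn (fun e => _ /\ _) => apply Dfn_and; dfn
  | |- Dfn (fun e => _ \/ _) => apply Dfn_or; dfn
  | |- Dfn (fun e => ~ _) => apply Dfn_not; dfn
  | |- Dfn (fun e => exists x, _) => apply Dfn_ex; dfn
  | |- Dfn (fun e => @?P e -> @?Q e) => apply Dfn_imp; dfn
  | |- Dfn (fun e => forall x, _) => apply Dfn_all; dfn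
  | |- Dfn (fun e => ?R (@?s e) (@?t e)) => apply (Dfn2_app R); dfn
  | |- Dfn (fun e => ?P (@?t e)) => apply (Dfn1_app P); dfn
  | |- DfnT (fun e => e _) => apply DfnT_var
  | |- DfnT (fun _ => ?c) => apply DfnT_const
  | |- DfnT (fun e => ?F (@?s e) (@?t e)) => apply (DfnF2_app F); dfn
  | |- DfnT (fun e => ?F (@?t e)) => apply (DfnF1_app F); dfn
  | |- Dfn2 ?R =>
      first [solve [auto with definability nocore] | unfold Dfn2; try unfold R; dfn]
  | |- Dfn1 ?R =>
      first [solve [auto with definability nocore] | unfold Dfn1; try unfold R; dfn]
  | |- _ => solve [auto with definability nocore]
  end.

(** * Sets from definable and bounded conditions *)

(** The size condition for set existence. Together with definability it is all that [is_set_intro]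
    asks of the truth condition and of the non-falsity condition. *)
Definition bounded (P : M -> Prop) : Prop := exists C, forall x, P x -> tin x C.

Definition is_set (P Q : M -> Prop) : Prop :=
  exists B, forall x, (tin x B <-> P x) /\ (qin x B <-> Q x).

(** [{x : ...}] with truth condition [P] and non-falsity condition [Q];
    arbitrary unless [is_set P Q]. *)
Definition mk (P Q : M -> Prop) : M :=
  epsilon (dom_inhabited M)
    (fun B => forall x, (tin x B <-> P x) /\ (qin x B <-> Q x)).

Lemma mkE P Q : is_set P Q ->
  forall x, (tin x (mk P Q) <-> P x) /\ (qin x (mk P Q) <-> Q x).
Proof. intros H. exact (epsilon_spec _ _ H). Qed.

Lemma mk_unique P Q A : is_set P Q ->
  (A = mk P Q <-> forall x, (tin x A <-> P x) /\ (qin x A <-> Q x)).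
Proof.
  intros H. split.
  - intros ->. now apply mkE.
  - intros G. apply set_ext; intros x;
      destruct (G x) as [G1 G2]; destruct (mkE P Q H x) as [H1 H2].
    + now rewrite G1, H1.
    + now rewrite G2, H2.
Qed.

Lemma DfnT_mk (P Q : M -> (nat -> M) -> Prop) :
  (forall e, is_set (fun x => P x e) (fun x => Q x e)) ->
  Dfn (fun e => P (e 0) (fun i => e (S i))) ->
  Dfn (fun e => Q (e 0) (fun i => e (S i))) ->
  DfnT (fun e => mk (fun x => P x e) (fun x => Q x e)).
Proof.
  intros H HP HQ.
  apply Dfn_ext with (P := fun e =>
    forall x, (tin x (e 0) <-> P x (fun i => e (S i)))
      /\ (qin x (e 0) <-> Q x (fun i => e (S i)))).
  - intros e. symmetry. apply (mk_unique (fun x => P x _) (fun x => Q x _)), H.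
  - set (s := fun i => match i with 0 => 0 | S i => S (S i) end).
    assert (Hs : forall i j, s i = s j -> i = j) by (intros [|i] [|j]; cbn; lia).
    apply (Dfn_all (fun x e => (tin x (e 0) <-> P x (fun i => e (S i)))
      /\ (qin x (e 0) <-> Q x (fun i => e (S i))))).
    apply Dfn_and; apply Dfn_iff.
    + dfn.
    + exact (Dfn_ren s Hs _ HP).
    + dfn.
    + exact (Dfn_ren s Hs _ HQ).
Qed.

(** Classical sets; not to be confused with proper classes. *)
Definition Class A : Prop := forall x, tin x A <-> qin x A.

Lemma Class_ext A B : Class A -> Class B ->
  (forall x, tin x A <-> tin x B) -> A = B.
Proof.
  intros H H' E. apply set_ext; [exact E|].
  intros x. rewrite <- (H x), <- (H' x). apply E.
Qed.

Lemma class_superset A :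
  exists C, Class C /\ forall x, tin x A \/ qin x A -> tin x C.
Proof.
  destruct (HM _ ax_classical_superset (fun _ => A) A) as [C HC]. cbn in HC.
  exists C. unfold Class, tin, qin. destruct HC as [H1 H2].
  split; intros x; specialize (H1 x); specialize (H2 x); tauto.
Qed.

Lemma bounded_sub (P Q : M -> Prop) :
  (forall x, P x -> Q x) -> bounded Q -> bounded P.
Proof. intros H [C HC]. exists C. auto. Qed.

Lemma bounded_in A : bounded (fun x => tin x A \/ qin x A).
Proof. destruct (class_superset A) as [C [_ H]]. now exists C. Qed.

(** Comprehension intersects [P] with the true members of the ambient set and [Q] with its non-false
    members. Separation therefore takes place in a classical set containing both extensions: a
    classical superset of the union of the classical sets given by [P] and [Q]. *)
Lemma is_set_intro P Q :
  Dfn1 P -> Dfn1 Q -> bounded P -> bounded Q -> is_set P Q.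
Proof.
  assert (K : forall P, Dfn1 P -> bounded P ->
    exists B, Class B /\ forall x, tin x B <-> P x).
  { intros R HR [A HA]. destruct (class_superset A) as [C [H1 H2]].
    destruct (comprehension_mixed R R C HR HR) as [B HB].
    exists B. split; intros x; destruct (HB x) as [H3 H4].
    - rewrite H3, H4. now rewrite (H1 x).
    - rewrite H3. split; [tauto|]. intros Px. split; [apply H2; left; auto|exact Px]. }
  intros HP HQ bP bQ.
  destruct (K P HP bP) as [B [HB1 HB2]], (K Q HQ bQ) as [C [HC1 HC2]].
  destruct (HM _ ax_pairing (fun _ => B) B C) as [D HD]. cbn in HD.
  destruct (HM _ ax_union (fun _ => B) D) as [U HU]. cbn in HU.
  destruct (class_superset U) as [V [HV1 HV2]].
  destruct (comprehension_mixed P Q V HP HQ) as [E HE].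
  assert (W : forall x, P x \/ Q x -> tin x V).
  { intros x Hx. apply HV2. left. unfold tin. apply HU.
    destruct Hx as [Hx|Hx].
    - exists B. split; [apply HD; auto|]. now apply HB2.
    - exists C. split; [apply HD; auto|]. now apply HC2. }
  exists E. intros x. destruct (HE x) as [H1 H2]. rewrite H1, H2, <- (HV1 x).
  specialize (W x). tauto.
Qed.

Lemma bounded_or P Q : bounded P -> bounded Q -> bounded (fun x => P x \/ Q x).
Proof.
  intros [B HB] [C HC].
  destruct (HM _ ax_pairing (fun _ => B) B C) as [D HD]. cbn in HD.
  destruct (HM _ ax_union (fun _ => B) D) as [U HU]. cbn in HU.
  exists U. intros x Hx. unfold tin. apply HU.
  destruct Hx as [Hx|Hx].
  - exists B. split; [apply HD; auto|]. now apply HB.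
  - exists C. split; [apply HD; auto|]. now apply HC.
Qed.

Lemma bounded_eq a : bounded (fun x => x = a).
Proof.
  destruct (HM _ ax_pairing (fun _ => a) a a) as [D HD]. cbn in HD.
  exists D. intros x ->. apply HD. auto.
Qed.

Lemma bounded_false : bounded (fun _ => False).
Proof. destruct (dom_inhabited M) as [d]. now exists d. Qed.

Lemma bounded_big (P : M -> Prop) :
  bounded P -> bounded (fun x => exists y, P y /\ tin x y).
Proof.
  intros [C HC].
  destruct (HM _ ax_union (fun _ => C) C) as [U HU]. cbn in HU.
  exists U. intros x [y [Hy Hx]]. apply HU. exists y. split; [now apply HC|exact Hx].
Qed.

Lemma bounded_rel (P : M -> Prop) (R : M -> M -> Prop) : Dfn2 R ->
  (forall x y y', R x y -> R x y' -> y = y') -> bounded P ->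
  bounded (fun y => exists x, P x /\ R x y).
Proof.
  intros HR F [C HC]. destruct (replacement_sem R C HR F) as [B HB].
  exists B. intros y [x [Hx Hy]]. apply HB. exists x. auto.
Qed.

Lemma bounded_image (P : M -> Prop) (F : M -> M) : DfnF1 F -> bounded P ->
  bounded (fun y => exists x, P x /\ y = F x).
Proof.
  intros HF. apply bounded_rel; [|congruence].
  exact (Dfn_ren (fun i => match i with 0 => 1 | 1 => 0 | S i => S i end)
    ltac:(intros [|[|i]] [|[|j]]; lia) _ HF).
Qed.

Lemma is_set_class P : Dfn1 P -> bounded P -> is_set P P.
Proof. intros. now apply is_set_intro. Qed.

(** Replacement is unary, so it is used twice: for fixed [x] the values [F x y] form a set [G x],
    and the union of all [G x] bounds the image. *)
Lemma bounded_image2 (P Q : M -> Prop) (F : M -> M -> M) : DfnF2 F ->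
  bounded P -> bounded Q ->
  bounded (fun z => exists x y, z = F x y /\ (P x /\ Q y)).
Proof.
  intros HF HP [C HC].
  set (G := fun x => mk (fun z => exists y, tin y C /\ z = F x y)
                        (fun z => exists y, tin y C /\ z = F x y)).
  assert (S : forall x, is_set (fun z => exists y, tin y C /\ z = F x y)
                               (fun z => exists y, tin y C /\ z = F x y)).
  { intros x. apply is_set_class; [dfn|].
    apply bounded_image; [unfold DfnF1; dfn|]. now exists C. }
  assert (HG : DfnF1 G).
  { apply (DfnT_mk (fun z e => exists y, tin y C /\ z = F (e 0) y)
      (fun z e => exists y, tin y C /\ z = F (e 0) y)); [intros e; apply S|dfn|dfn]. }
  apply bounded_sub with
    (Q := fun z => exists X, (exists x, P x /\ X = G x) /\ tin z X).
  - intros z (x & y & -> & Hx & Hy). exists (G x). split; [now exists x|].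
    apply (mkE _ _ (S x)). exists y. auto.
  - apply bounded_big, bounded_image; assumption.
Qed.

Lemma bounded_pow A :
  bounded (fun X => Class X /\ forall x, tin x X -> tin x A).
Proof.
  destruct (class_superset A) as [C [HC HA]].
  destruct (HM _ ax_power_set (fun _ => A) C) as [P HP]. cbn in HP.
  exists P. intros X [HX H]. unfold tin. apply HP. split; [|exact I].
  intros x. specialize (H x). specialize (HX x). specialize (HC x).
  specialize (HA x). unfold tin, qin in *. split; [tauto|].
  intros K. apply NNPP. tauto.
Qed.

Lemma bounded_tin A : bounded (fun x => tin x A).
Proof. now exists A. Qed.

Lemma bounded_qin A : bounded (fun x => qin x A).
Proof. eapply bounded_sub; [|apply (bounded_in A)]. simpl; auto. Qed.

(** [bng A] is [A^!], [qst A] is [A^?], [mixd X Y] is [⟨X|Y⟩], and [kp a b] is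
    the Kuratowski pair. *)
Definition emp : M := mk (fun _ => False) (fun _ => False).
Definition sing a : M := mk (fun x => x = a) (fun x => x = a).
Definition upr a b : M := mk (fun x => x = a \/ x = b) (fun x => x = a \/ x = b).
Definition cup A B : M :=
  mk (fun x => tin x A \/ tin x B) (fun x => qin x A \/ qin x B).
Definition cap A B : M :=
  mk (fun x => tin x A /\ tin x B) (fun x => qin x A /\ qin x B).
Definition dif A B : M :=
  mk (fun x => tin x A /\ ~ qin x B) (fun x => qin x A /\ ~ tin x B).
Definition bng A : M := mk (fun x => tin x A) (fun x => tin x A).
Definition qst A : M := mk (fun x => qin x A) (fun x => qin x A).
Definition mixd X Y : M := mk (fun x => tin x X) (fun x => qin x Y).
Definition kp a b : M := upr (sing a) (upr a b).

Lemma emp_set : is_set (fun _ => False) (fun _ => False).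
Proof.
  apply is_set_class; [dfn|apply bounded_false].
Qed.

Lemma sing_set a : is_set (fun x => x = a) (fun x => x = a).
Proof. apply is_set_class; [dfn|apply bounded_eq]. Qed.

Lemma upr_set a b : is_set (fun x => x = a \/ x = b) (fun x => x = a \/ x = b).
Proof.
  apply is_set_class; [dfn|].
  apply bounded_or; apply bounded_eq.
Qed.

Lemma cup_set A B :
  is_set (fun x => tin x A \/ tin x B) (fun x => qin x A \/ qin x B).
Proof.
  apply is_set_intro; [dfn|dfn| |]; apply bounded_or;
    apply bounded_tin || apply bounded_qin.
Qed.

Lemma cap_set A B :
  is_set (fun x => tin x A /\ tin x B) (fun x => qin x A /\ qin x B).
Proof.
  apply is_set_intro; [dfn|dfn| |].
  - apply bounded_sub with (Q := fun x => tin x A); [tauto|apply bounded_tin].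
  - apply bounded_sub with (Q := fun x => qin x A); [tauto|apply bounded_qin].
Qed.

Lemma dif_set A B :
  is_set (fun x => tin x A /\ ~ qin x B) (fun x => qin x A /\ ~ tin x B).
Proof.
  apply is_set_intro; [dfn|dfn| |].
  - apply bounded_sub with (Q := fun x => tin x A); [tauto|apply bounded_tin].
  - apply bounded_sub with (Q := fun x => qin x A); [tauto|apply bounded_qin].
Qed.

Lemma bng_set A : is_set (fun x => tin x A) (fun x => tin x A).
Proof. apply is_set_class; [dfn|apply bounded_tin]. Qed.

Lemma qst_set A : is_set (fun x => qin x A) (fun x => qin x A).
Proof. apply is_set_class; [dfn|apply bounded_qin]. Qed.

Lemma mixd_set X Y : is_set (fun x => tin x X) (fun x => qin x Y).
Proof.
  apply is_set_intro; [dfn|dfn|apply bounded_tin|apply bounded_qin].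
Qed.

Lemma sing_dfn : DfnF1 sing.
Proof.
  apply (DfnT_mk (fun x e => x = e 0) (fun x e => x = e 0));
    [intros e; apply sing_set|dfn|dfn].
Qed.

Lemma upr_dfn : DfnF2 upr.
Proof.
  apply (DfnT_mk (fun x e => x = e 0 \/ x = e 1)
    (fun x e => x = e 0 \/ x = e 1)); [intros e; apply upr_set|dfn|dfn].
Qed.

Hint Resolve sing_dfn upr_dfn : definability.

Lemma kp_dfn : DfnF2 kp.
Proof. unfold DfnF2, kp. dfn. Qed.

Hint Resolve kp_dfn : definability.

Lemma tin_sing a x : tin x (sing a) <-> x = a.
Proof. apply (mkE _ _ (sing_set a)). Qed.

Lemma tin_upr a b x : tin x (upr a b) <-> x = a \/ x = b.
Proof. apply (mkE _ _ (upr_set a b)). Qed.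

Lemma upr_inj a b c : upr a b = upr a c -> b = c.
Proof.
  intros H.
  assert (K : forall x, x = a \/ x = b <-> x = a \/ x = c).
  { intros x. now rewrite <- !tin_upr, H. }
  destruct (proj1 (K b) (or_intror eq_refl)) as [E|E]; [|exact E].
  destruct (proj2 (K c) (or_intror eq_refl)); congruence.
Qed.

Lemma sing_upr a b c : sing a = upr b c -> a = b /\ a = c.
Proof.
  intros H.
  assert (K : forall x, x = a <-> x = b \/ x = c).
  { intros x. now rewrite <- tin_upr, <- tin_sing, H. }
  split; symmetry; apply K; auto.
Qed.

Lemma sing_inj a b : sing a = sing b -> a = b.
Proof. intros H. apply tin_sing. rewrite <- H. now apply tin_sing. Qed.

Lemma kp_inj a b c d : kp a b = kp c d -> a = c /\ b = d.
Proof.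
  intros H.
  assert (K : forall x, x = sing a \/ x = upr a b <-> x = sing c \/ x = upr c d).
  { intros x. unfold kp in H. now rewrite <- !tin_upr, H. }
  assert (E : a = c).
  { destruct (proj1 (K (sing a)) (or_introl eq_refl)) as [E|E].
    - now apply sing_inj.
    - now apply sing_upr in E. }
  subst c. split; [reflexivity|].
  destruct (proj1 (K (upr a b)) (or_intror eq_refl)) as [E|E].
  - symmetry in E. apply sing_upr in E as [_ E].
    destruct (proj2 (K (upr a d)) (or_intror eq_refl)) as [E'|E'].
    + symmetry in E'. apply sing_upr in E'. destruct E'; congruence.
    + symmetry. now apply upr_inj in E'.
  - now apply upr_inj in E.
Qed.

Definition one : M := sing emp.

Lemma not_tin_emp x : ~ tin x emp.
Proof. intros H. now apply (mkE _ _ emp_set x) in H. Qed.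

Lemma not_qin_emp x : ~ qin x emp.
Proof. exact (proj1 (proj2 (mkE _ _ emp_set x))). Qed.

Lemma emp_one : emp <> one.
Proof.
  intros H. apply (not_tin_emp emp). rewrite H at 2. now apply tin_sing.
Qed.

(** * Ordered pairs, products and disjoint sums *)

Definition opair a b : M :=
  mk (fun z => (exists u, z = kp emp u /\ tin u a) \/ (exists u, z = kp one u /\ tin u b))
     (fun z => (exists u, z = kp emp u /\ qin u a) \/ (exists u, z = kp one u /\ qin u b)).

Lemma bounded_tag (P : M -> Prop) i :
  bounded P -> bounded (fun z => exists u, z = kp i u /\ P u).
Proof.
  intros H.
  eapply bounded_sub; [|apply (bounded_image P (fun u => kp i u)); [|exact H]].
  - simpl. intros z [u Hu]. exists u. tauto.
  - unfold DfnF1. dfn.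
Qed.

Lemma opair_set a b : is_set
  (fun z => (exists u, z = kp emp u /\ tin u a) \/ (exists u, z = kp one u /\ tin u b))
  (fun z => (exists u, z = kp emp u /\ qin u a) \/ (exists u, z = kp one u /\ qin u b)).
Proof.
  apply is_set_intro; [dfn|dfn| |]; apply bounded_or;
    apply bounded_tag; apply bounded_tin || apply bounded_qin.
Qed.

Lemma opair_dfn : DfnF2 opair.
Proof.
  apply (DfnT_mk
    (fun z e => (exists u, z = kp emp u /\ tin u (e 0))
             \/ (exists u, z = kp one u /\ tin u (e 1)))
    (fun z e => (exists u, z = kp emp u /\ qin u (e 0))
             \/ (exists u, z = kp one u /\ qin u (e 1))));
    [intros e; apply opair_set|dfn|dfn].
Qed.

Hint Resolve opair_dfn : definability.

(** The statuses of [kp emp u] and [kp one u] in the pair are those of [u] in the two components,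
    both for [tin] and for [qin], so extensionality recovers the components. *)
Lemma opair_inj a b c d : opair a b = opair c d -> a = c /\ b = d.
Proof.
  intros H.
  assert (K : forall a b u,
    (tin (kp emp u) (opair a b) <-> tin u a) /\
    (qin (kp emp u) (opair a b) <-> qin u a) /\
    (tin (kp one u) (opair a b) <-> tin u b) /\
    (qin (kp one u) (opair a b) <-> qin u b)).
  { clear - HM. intros a b u. pose proof emp_one as N.
    destruct (mkE _ _ (opair_set a b) (kp emp u)) as [H1 H2],
      (mkE _ _ (opair_set a b) (kp one u)) as [H3 H4].
    fold (opair a b) in *. rewrite H1, H2, H3, H4.
    repeat split;
      try (intros [[v [E V]]|[v [E V]]]; apply kp_inj in E as [E1 E2];
        congruence);
      intros V; eauto. }
  split; apply set_ext; intros u; specialize (K a b u) as K1;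
    specialize (K c d u) as K2; rewrite H in K1; tauto.
Qed.

Definition prd A B : M :=
  mk (fun z => exists x y, z = opair x y /\ (tin x A /\ tin y B))
     (fun z => exists x y, z = opair x y /\ (qin x A /\ qin y B)).
Definition tgd A i : M :=
  mk (fun z => exists x, z = opair x i /\ tin x A)
     (fun z => exists x, z = opair x i /\ qin x A).
Definition dsm A B : M := cup (tgd A emp) (tgd B one).

Lemma prd_set A B : is_set
  (fun z => exists x y, z = opair x y /\ (tin x A /\ tin y B))
  (fun z => exists x y, z = opair x y /\ (qin x A /\ qin y B)).
Proof.
  apply is_set_intro; [dfn|dfn| |]; apply bounded_image2;
    apply opair_dfn || apply bounded_tin || apply bounded_qin.
Qed.

Lemma tgd_set A i : is_set
  (fun z => exists x, z = opair x i /\ tin x A)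
  (fun z => exists x, z = opair x i /\ qin x A).
Proof.
  assert (K : forall P : M -> Prop, bounded P ->
    bounded (fun z => exists x, z = opair x i /\ P x)).
  { intros P H.
    eapply bounded_sub;
      [|apply (bounded_image P (fun u => opair u i)); [|exact H]].
    - simpl. intros z [u Hu]. exists u. tauto.
    - unfold DfnF1. dfn. }
  apply is_set_intro; [dfn|dfn| |]; apply K;
    apply bounded_tin || apply bounded_qin.
Qed.

Lemma tin_prd A B x y : tin (opair x y) (prd A B) <-> tin x A /\ tin y B.
Proof.
  destruct (mkE _ _ (prd_set A B) (opair x y)) as [H _]. fold (prd A B) in H.
  rewrite H. split; [|eauto].
  intros (x' & y' & E & K). apply opair_inj in E as [-> ->]. exact K.
Qed.

Lemma qin_prd A B x y : qin (opair x y) (prd A B) <-> qin x A /\ qin y B.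
Proof.
  destruct (mkE _ _ (prd_set A B) (opair x y)) as [_ H]. fold (prd A B) in H.
  rewrite H. split; [|eauto].
  intros (x' & y' & E & K). apply opair_inj in E as [-> ->]. exact K.
Qed.

Lemma prd_inv A B z : tin z (prd A B) \/ qin z (prd A B) ->
  exists x y, z = opair x y.
Proof.
  intros [H|H]; apply (mkE _ _ (prd_set A B)) in H;
    destruct H as (x & y & -> & _); eauto.
Qed.

Lemma dsm_mem A B z :
  (tin z (dsm A B) <-> (exists x, z = opair x emp /\ tin x A)
    \/ (exists x, z = opair x one /\ tin x B)) /\
  (qin z (dsm A B) <-> (exists x, z = opair x emp /\ qin x A)
    \/ (exists x, z = opair x one /\ qin x B)).
Proof.
  destruct (mkE _ _ (cup_set (tgd A emp) (tgd B one)) z) as [H1 H2].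
  destruct (mkE _ _ (tgd_set A emp) z), (mkE _ _ (tgd_set B one) z).
  fold (tgd A emp) in *. fold (tgd B one) in *. unfold dsm, cup. tauto.
Qed.

Lemma dsm_left A B x :
  (tin (opair x emp) (dsm A B) <-> tin x A) /\
  (qin (opair x emp) (dsm A B) <-> qin x A).
Proof.
  pose proof emp_one.
  destruct (dsm_mem A B (opair x emp)) as [-> ->]. split; split; eauto;
    intros [[y [E K]]|[y [E K]]]; apply opair_inj in E as [E1 E2]; congruence.
Qed.

Lemma dsm_right A B x :
  (tin (opair x one) (dsm A B) <-> tin x B) /\
  (qin (opair x one) (dsm A B) <-> qin x B).
Proof.
  pose proof emp_one.
  destruct (dsm_mem A B (opair x one)) as [-> ->]. split; split; eauto;
    intros [[y [E K]]|[y [E K]]]; apply opair_inj in E as [E1 E2]; congruence.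
Qed.

Lemma dsm_inv A B z : tin z (dsm A B) \/ qin z (dsm A B) ->
  exists x, z = opair x emp \/ z = opair x one.
Proof.
  intros [H|H]; apply (dsm_mem A B z) in H as [[x [E _]]|[x [E _]]]; eauto.
Qed.

(** * Ordinals and bijections *)

Definition Sub A B : Prop :=
  forall x, (tin x A -> tin x B) /\ (qin x A -> qin x B).

(** Clause by clause the truth condition of [ordinal], so that [tr_eval] can match the two; [Fun]
    and [Bij] follow [function_on] and [bijection] in the same way. *)
Definition Ord a : Prop :=
  Class a
  /\ (forall x, tin x a -> Class x)
  /\ (forall x, tin x a -> Sub x a)
  /\ (forall x, tin x a -> forall y, tin y a -> tin x y \/ x = y \/ tin y x)
  /\ (forall s, Class s /\ Sub s a /\ (exists x, tin x s) ->
       exists m, tin m s /\ forall x, tin x s -> ~ tin x m).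

Lemma Ord_dfn : Dfn1 Ord.
Proof. dfn. Qed.

Hint Resolve Ord_dfn : definability.

Lemma Ord_trans a x y : Ord a -> tin x a -> tin y x -> tin y a.
Proof. intros (_ & _ & H & _) Hx. now apply H. Qed.

(** Well-foundedness in [Ord] concerns subsets only, so [P] has to be definable for its part below
    [a] to be a set. *)
Lemma Ord_min a (P : M -> Prop) : Dfn1 P -> Ord a -> (exists x, tin x a /\ P x) ->
  exists m, tin m a /\ P m /\ forall x, tin x a -> P x -> ~ tin x m.
Proof.
  intros HP (Ha & _ & _ & _ & W) (x & Hx & Px).
  assert (S : is_set (fun z => tin z a /\ P z) (fun z => tin z a /\ P z)).
  { apply is_set_class; [dfn|].
    apply bounded_sub with (Q := fun z => tin z a); [tauto|].
    apply bounded_tin. }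
  destruct (W (mk (fun z => tin z a /\ P z) (fun z => tin z a /\ P z)))
    as (m & Hm & K).
  - split; [|split].
    + intros z. destruct (mkE _ _ S z). tauto.
    + intros z. destruct (mkE _ _ S z). specialize (Ha z). tauto.
    + exists x. destruct (mkE _ _ S x). tauto.
  - exists m. apply (mkE _ _ S m) in Hm. split; [tauto|split; [tauto|]].
    intros z Hz Pz. apply K. now apply (mkE _ _ S z).
Qed.

Lemma Ord_elem_irrefl a x : Ord a -> tin x a -> ~ tin x x.
Proof.
  intros Ha Hx.
  (* The least element of [{x}] can only be [x], and no element of [{x}] belongs to it. *)
  destruct (Ord_min a (fun z => z = x)) as (m & _ & -> & K); eauto.
  dfn.
Qed.

Lemma Ord_irrefl a : Ord a -> ~ tin a a.
Proof. intros Ha H. exact (Ord_elem_irrefl a a Ha H H). Qed.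

Lemma Ord_sub a s : Ord a -> Class s -> (forall x, tin x s -> tin x a) ->
  (forall x y, tin x s -> tin y x -> tin y s) -> Ord s.
Proof.
  intros (Ha & H1 & H2 & H3 & H4) Hs S T.
  split; [exact Hs|]. split; [auto|]. split; [|split].
  - intros x Hx z. specialize (T x z Hx). specialize (H1 x (S x Hx) z).
    specialize (Hs z). tauto.
  - auto.
  - intros s' (K1 & K2 & K3). apply H4. split; [exact K1|]. split; [|exact K3].
    intros z. specialize (K1 z). specialize (K2 z). specialize (S z).
    specialize (Ha z). tauto.
Qed.

Lemma Ord_elem a x : Ord a -> tin x a -> Ord x.
Proof.
  intros Ha Hx. apply (Ord_sub a x Ha).
  - destruct Ha as (_ & H & _). auto.
  - intros y. now apply (Ord_trans a x y).
  - intros y z Hy Hz.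
    assert (Hya : tin y a) by eauto using Ord_trans.
    assert (Hza : tin z a) by eauto using Ord_trans.
    (* By trichotomy, [z] not in [x] would mean [z = x] or [x] in [z]. Either closes a membership
       cycle through [x], [y] and [z], which a least element among the three excludes. *)
    assert (L : exists m, tin m a /\ (m = x \/ m = y \/ m = z) /\
      forall w, tin w a -> w = x \/ w = y \/ w = z -> ~ tin w m).
    { apply (Ord_min a (fun w => w = x \/ w = y \/ w = z)); [dfn|exact Ha|eauto]. }
    destruct L as (m & _ & Hm & K).
    pose proof Ha as (_ & _ & _ & T & _).
    destruct (T z Hza x Hx) as [H|[->|H]]; [exact H| |].
    + destruct Hm as [-> | [-> | ->] ];
        solve [destruct (K x); auto | destruct (K y); auto].
    + destruct Hm as [-> | [-> | ->] ];
        [destruct (K y)|destruct (K z)|destruct (K x)]; auto.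
Qed.

Lemma Ord_subset_mem a b : Ord a -> Ord b -> (forall x, tin x a -> tin x b) ->
  a = b \/ tin a b.
Proof.
  intros Ha Hb S.
  destruct (classic (exists x, tin x b /\ ~ tin x a)) as [N|N].
  (* The least element of [b] outside [a] turns out to be [a] itself. *)
  - right. destruct (Ord_min b (fun x => ~ tin x a)) as (m & Hm & Nm & K).
    { dfn. }
    { exact Hb. }
    { exact N. }
    replace a with m; [exact Hm|].
    apply Class_ext.
    + destruct Hb as (_ & H & _). auto.
    + exact (proj1 Ha).
    + intros x. split.
      * intros Hx. apply NNPP. intros Nx. apply (K x); auto.
        eauto using Ord_trans.
      * intros Hx. pose proof Hb as (_ & _ & _ & T & _).
        destruct (T x (S x Hx) m Hm) as [H|[->|H]]; [exact H|tauto|].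
        destruct Nm. eauto using Ord_trans.
  - left. apply Class_ext; [exact (proj1 Ha)|exact (proj1 Hb)|].
    intros x. split; [apply S|]. intros Hx. apply NNPP. eauto.
Qed.

(** The intersection [i] is an ordinal contained in both. If it equalled neither, it would be an
    element of both, hence of itself. *)
Lemma Ord_tricho a b : Ord a -> Ord b -> tin a b \/ a = b \/ tin b a.
Proof.
  intros Ha Hb.
  assert (S : is_set (fun x => tin x a /\ tin x b) (fun x => tin x a /\ tin x b)).
  { apply is_set_class; [dfn|].
    apply bounded_sub with (Q := fun z => tin z a); [tauto|].
    apply bounded_tin. }
  set (i := mk (fun x => tin x a /\ tin x b) (fun x => tin x a /\ tin x b)).
  assert (I : forall x, tin x i <-> tin x a /\ tin x b) by apply (mkE _ _ S).
  assert (Hi : Ord i).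
  { apply (Ord_sub a); [exact Ha| | |].
    - intros x. destruct (mkE _ _ S x) as [H1 H2].
      fold i in H1, H2. now rewrite H1, H2.
    - intros x Hx. now apply I.
    - intros x y Hx Hy. apply I in Hx. apply I.
      split; [apply (Ord_trans a x)|apply (Ord_trans b x)]; tauto. }
  destruct (Ord_subset_mem i a Hi Ha) as [Ea|Ea].
  { intros x Hx. now apply I. }
  - destruct (Ord_subset_mem a b Ha Hb) as [E|E]; auto.
    intros x. rewrite <- Ea. intros Hx. now apply I.
  - destruct (Ord_subset_mem i b Hi Hb) as [Eb|Eb].
    + intros x Hx. now apply I.
    + right. right. now rewrite <- Eb.
    + destruct (Ord_irrefl i Hi). now apply I.
Qed.

Lemma Ord_least (P : M -> Prop) : Dfn1 P -> (exists a, Ord a /\ P a) ->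
  exists a, Ord a /\ P a /\ forall b, Ord b -> P b -> a = b \/ tin a b.
Proof.
  intros HP (a & Ha & Pa).
  destruct (classic (exists b, tin b a /\ P b)) as [N|N].
  - destruct (Ord_min a P HP Ha N) as (m & Hm & Pm & K).
    exists m. split; [now apply (Ord_elem a)|]. split; [exact Pm|].
    intros b Hb Pb.
    destruct (Ord_tricho m b) as [H|[H|H]]; auto.
    { now apply (Ord_elem a). }
    destruct (K b); auto. now apply (Ord_trans a m).
  - exists a. split; [exact Ha|]. split; [exact Pa|].
    intros b Hb Pb. destruct (Ord_tricho a b) as [H|[H|H]]; auto.
    destruct N. eauto.
Qed.

(** Burali-Forti: a set of all ordinals would be an ordinal and so its own element. *)
Lemma Ord_unbounded : ~ bounded Ord.
Proof.
  intros B.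
  pose proof (is_set_class Ord Ord_dfn B) as S.
  set (o := mk Ord Ord).
  assert (I : forall x, tin x o <-> Ord x) by apply (mkE _ _ S).
  assert (C : Class o).
  { intros x. destruct (mkE _ _ S x) as [H1 H2].
    fold o in H1, H2. now rewrite H1, H2. }
  assert (O : Ord o).
  { split; [exact C|]. split; [|split; [|split]].
    - intros x Hx. apply I in Hx. exact (proj1 Hx).
    - intros x Hx z. apply I in Hx. rewrite <- (C z), (I z).
      pose proof (Ord_elem x z Hx) as E. pose proof (proj1 Hx z). tauto.
    - intros x Hx y Hy. apply I in Hx, Hy. now apply Ord_tricho.
    - intros s (H1 & H2 & x & Hx).
      assert (K : forall z, tin z s -> Ord z)
        by (intros z Hz; apply I; now apply H2).
      destruct (Ord_least (fun z => tin z s)) as (m & Om & Hm & L);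
        [dfn|eauto|].
      exists m. split; [exact Hm|]. intros z Hz Hzm.
      destruct (L z (K z Hz) Hz) as [->|E].
      + now apply (Ord_irrefl z (K z Hz)).
      + apply (Ord_irrefl z (K z Hz)). apply (Ord_trans z m); auto. }
  apply (Ord_irrefl o O). now apply I.
Qed.

(** * Functions and equinumerosity *)

Definition Fun f X : Prop :=
  Class f
  /\ (forall z, tin z f -> exists x, tin x X /\ exists y, z = opair x y)
  /\ (forall x, tin x X -> exists y, forall v, tin (opair x v) f <-> v = y).

Definition Bij f X Y : Prop :=
  Fun f X
  /\ (forall x y, tin (opair x y) f -> tin y Y)
  /\ (forall y, tin y Y -> exists x, forall u, tin (opair u y) f <-> u = x).

Definition Equi X Y : Prop := exists f, Bij f X Y.

Lemma Equi_dfn : Dfn2 Equi.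
Proof. unfold Dfn2, Equi, Bij, Fun. dfn. Qed.

Hint Resolve Equi_dfn : definability.

(** Nothing is demanded of [R] outside [P] and [Q], so the same relation can be restricted to
    smaller domains without being changed. *)
Definition bijective_rel (R : M -> M -> Prop) (P Q : M -> Prop) : Prop :=
  (forall x, P x -> exists y, Q y /\ R x y)
  /\ (forall y, Q y -> exists x, P x /\ R x y)
  /\ (forall x y y', P x -> Q y -> Q y' -> R x y -> R x y' -> y = y')
  /\ (forall x x' y, P x -> P x' -> Q y -> R x y -> R x' y -> x = x').

(** The graph of [R] between [X] and [Y] is bounded by their product, hence a set. Together with
    [Equi_elim] this trades sets of pairs for definable relations, which are easier to compose,
    restrict and glue. *)
Lemma Equi_intro (R : M -> M -> Prop) X Y : Dfn2 R ->
  bijective_rel R (fun x => tin x X) (fun y => tin y Y) -> Equi X Y.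
Proof.
  intros HR (H1 & H2 & H3 & H4).
  set (P := fun z => exists x y, z = opair x y /\ (tin x X /\ (tin y Y /\ R x y))).
  assert (S : is_set P P).
  { apply is_set_class; [unfold P; dfn|].
    apply bounded_sub with
      (Q := fun z => exists x y, z = opair x y /\ (tin x X /\ tin y Y)).
    - intros z (x & y & K). exists x, y. tauto.
    - apply bounded_image2; apply bounded_tin || apply opair_dfn. }
  assert (I : forall x y, tin (opair x y) (mk P P) <-> tin x X /\ tin y Y /\ R x y).
  { intros x y. destruct (mkE _ _ S (opair x y)) as [-> _]. split.
    - intros (x' & y' & E & K). apply opair_inj in E as [-> ->]. exact K.
    - intros K. now exists x, y. }
  exists (mk P P). split; [split; [|split]|split].
  - intros z. destruct (mkE _ _ S z). tauto.
  - intros z Hz. destruct (mkE _ _ S z) as [K _]. apply K in Hz.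
    destruct Hz as (x & y & -> & Hx & _). eauto.
  - intros x Hx. destruct (H1 x Hx) as (y & Hy & Rxy). exists y. intros v.
    rewrite I. split; [|intros ->; tauto]. intros (_ & Hv & Rxv). eauto.
  - intros x y K. now apply I in K.
  - intros y Hy. destruct (H2 y Hy) as (x & Hx & Rxy). exists x. intros u.
    rewrite I. split; [|intros ->; tauto]. intros (Hu & _ & Ruy). eauto.
Qed.

Lemma Equi_elim X Y : Equi X Y ->
  exists R, Dfn2 R /\ bijective_rel R (fun x => tin x X) (fun y => tin y Y).
Proof.
  intros [f [(F1 & F2 & F3) [G1 G2]]].
  assert (D : forall x y, tin (opair x y) f -> tin x X).
  { intros x y K. destruct (F2 _ K) as (x' & Hx & y' & E).
    apply opair_inj in E as [-> ->]. exact Hx. }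
  exists (fun x y => tin (opair x y) f). split; [dfn|]. split; [|split; [|split]].
  - intros x Hx. destruct (F3 x Hx) as [y Hy]. exists y.
    assert (K : tin (opair x y) f) by now apply Hy. eauto.
  - intros y Hy. destruct (G2 y Hy) as [x Hx]. exists x.
    assert (K : tin (opair x y) f) by now apply Hx. eauto.
  - intros x y y' Hx _ _ K K'. destruct (F3 x Hx) as [w Hw].
    apply Hw in K, K'. congruence.
  - intros x x' y _ _ Hy K K'. destruct (G2 y Hy) as [w Hw].
    apply Hw in K, K'. congruence.
Qed.

Lemma Equi_sym X Y : Equi X Y -> Equi Y X.
Proof.
  intros H. destruct (Equi_elim X Y H) as (R & HR & H1 & H2 & H3 & H4).
  apply (Equi_intro (fun y x => R x y)); [dfn|].
  split; [exact H2|]. split; [exact H1|]. split; eauto.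
Qed.

Lemma Equi_trans X Y Z : Equi X Y -> Equi Y Z -> Equi X Z.
Proof.
  intros H H'. destruct (Equi_elim X Y H) as (R & HR & H1 & H2 & H3 & H4).
  destruct (Equi_elim Y Z H') as (R' & HR' & H1' & H2' & H3' & H4').
  apply (Equi_intro (fun x z => exists y, tin y Y /\ R x y /\ R' y z)); [dfn|].
  split; [|split; [|split]].
  - intros x Hx. destruct (H1 x Hx) as (y & Hy & K).
    destruct (H1' y Hy) as (z & Hz & K'). eauto 6.
  - intros z Hz. destruct (H2' z Hz) as (y & Hy & K).
    destruct (H2 y Hy) as (x & Hx & K'). eauto 6.
  - intros x z z' Hx Hz Hz' (y & Hy & K & K') (y' & Hy' & L & L').
    assert (y = y') by eauto. subst y'. eauto.
  - intros x x' z Hx Hx' Hz (y & Hy & K & K') (y' & Hy' & L & L').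
    assert (y = y') by eauto. subst y'. eauto.
Qed.

(** * Evaluation of formulas and terms *)

Lemma tr_all e k (p : nat -> fm) (P : M -> Prop) :
  (forall a, tr M (upd e k a) (p k (S k)) <-> P a) ->
  (tr M e (fAll p k) <-> forall a, P a).
Proof. intros H. split; intros G a; apply H, G. Qed.

Lemma tr_ex e k (p : nat -> fm) (P : M -> Prop) :
  (forall a, tr M (upd e k a) (p k (S k)) <-> P a) ->
  (tr M e (fEx p k) <-> exists a, P a).
Proof. intros H. split; intros [a G]; exists a; apply H, G. Qed.

Lemma tr_and e k p q (P Q : Prop) : (tr M e (p k) <-> P) -> (tr M e (q k) <-> Q) ->
  (tr M e (fAnd p q k) <-> P /\ Q).
Proof. simpl. tauto. Qed.

Lemma tr_or e k p q (P Q : Prop) : (tr M e (p k) <-> P) -> (tr M e (q k) <-> Q) ->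
  (tr M e (fOr p q k) <-> P \/ Q).
Proof. simpl. tauto. Qed.

Lemma tr_imp e k p q (P Q : Prop) : (tr M e (p k) <-> P) -> (tr M e (q k) <-> Q) ->
  (tr M e (fImp p q k) <-> (P -> Q)).
Proof. simpl. tauto. Qed.

Lemma tr_iff e k p q (P Q : Prop) : (tr M e (p k) <-> P) -> (tr M e (q k) <-> Q) ->
  (tr M e (fIff p q k) <-> (P <-> Q)).
Proof. simpl. tauto. Qed.

Lemma tr_not e k p (P : Prop) : (tr M e (p k) <-> P) ->
  (tr M e (fNot p k) <-> ~ P).
Proof. simpl. tauto. Qed.

Lemma tr_mem e k i j : tr M e (fMem i j k) <-> tin (e i) (e j).
Proof. reflexivity. Qed.

Lemma tr_eq e k i j : tr M e (fEq i j k) <-> e i = e j.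
Proof. reflexivity. Qed.

Lemma tr_all_in e k i A (p : nat -> fm) (P : M -> Prop) : i < k -> e i = A ->
  (forall a, tr M (upd e k a) (p k (S k)) <-> P a) ->
  (tr M e (all_in i p k) <-> forall a, tin a A -> P a).
Proof.
  intros Hi <- H. apply tr_all. intros a. apply tr_imp; [|apply H].
  rewrite tr_mem, upd_same, upd_lt by exact Hi. reflexivity.
Qed.

Lemma tr_ex_in e k i A (p : nat -> fm) (P : M -> Prop) : i < k -> e i = A ->
  (forall a, tr M (upd e k a) (p k (S k)) <-> P a) ->
  (tr M e (ex_in i p k) <-> exists a, tin a A /\ P a).
Proof.
  intros Hi <- H. apply tr_ex. intros a. rewrite <- (H a).
  (* [p & q] is true iff both are true: its definition as [~ (p → ~ q)] computes to this. *)
  transitivity (tin (upd e k a k) (upd e k a i) /\ tr M (upd e k a) (p k (S k)));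
    [reflexivity|].
  rewrite upd_same, upd_lt by exact Hi. reflexivity.
Qed.

(** The term [t], whose free variables are [< k], has value [c]. *)
Definition denotes k e t c : Prop :=
  forall k' e' v, k <= k' -> (forall i, i < k -> e' i = e i) -> v < k' ->
    (tr M e' (t v k') <-> e' v = c).

(** Stated at fixed arguments and value instead of for an operation on [M], because some terms are
    evaluated only at special arguments: [clcard] and [mix] at classical sets, [cadd] and [cmul] at
    cardinal numbers. *)
Definition graph1 (f : nat -> tm) a c : Prop :=
  forall k e i v, i < k -> v < k -> e i = a -> (tr M e (f i v k) <-> e v = c).
Definition graph2 (f : nat -> nat -> tm) a b c : Prop :=
  forall k e i j v, i < k -> j < k -> v < k -> e i = a -> e j = b ->
    (tr M e (f i j v k) <-> e v = c).
Definition graph3 (f : nat -> nat -> nat -> tm) a b c d : Prop :=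
  forall k e i j l v, i < k -> j < k -> l < k -> v < k ->
    e i = a -> e j = b -> e l = c -> (tr M e (f i j l v k) <-> e v = d).

Lemma denotes_at k e t c v : denotes k e t c -> v < k ->
  (tr M e (t v k) <-> e v = c).
Proof. intros H Hv. apply H; auto. Qed.

Lemma denotes_mono k e t c k' e' : denotes k e t c -> k <= k' ->
  (forall i, i < k -> e' i = e i) -> denotes k' e' t c.
Proof.
  intros H L E k2 e2 v L2 E2 Hv. apply H; [lia| |exact Hv].
  intros i Hi. rewrite E2 by lia. auto.
Qed.

Lemma denotes_upd k e t c a : denotes k e t c -> denotes (S k) (upd e k a) t c.
Proof.
  intros H. apply (denotes_mono k e t c); [exact H|lia|].
  intros i Hi. now apply upd_lt.
Qed.

Lemma denotes_var k e i : i < k -> denotes k e (var i) (e i).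
Proof.
  intros Hi k' e' v L E Hv. unfold var. rewrite tr_eq, (E i Hi). reflexivity.
Qed.

Lemma denotes_graph1 f a c k e i : graph1 f a c -> i < k -> e i = a ->
  denotes k e (f i) c.
Proof. intros H Hi E k' e' v L E' Hv. apply H; [lia|lia|]. now rewrite E'. Qed.

Lemma denotes_graph2 f a b c k e i j : graph2 f a b c -> i < k -> j < k ->
  e i = a -> e j = b -> denotes k e (f i j) c.
Proof.
  intros H Hi Hj Ei Ej k' e' v L E' Hv. apply H; try lia; now rewrite E'.
Qed.

Lemma tr_desc k e t c (p : nat -> fm) : denotes k e t c ->
  (tr M e (desc t p k) <-> tr M (upd e k c) (p k (S k))).
Proof.
  intros H.
  transitivity (exists a, (forall b, b = c <-> b = a)
    /\ tr M (upd e k a) (p k (S k))).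
  - apply tr_ex. intros a. apply tr_and; [|reflexivity].
    apply tr_all. intros b.
    assert (E : upd (upd e k a) (S k) b (S k) = b) by apply upd_same.
    apply tr_iff.
    + rewrite (H (S (S k)) _ (S k)); [now rewrite E|lia| |lia].
      intros i Hi. now rewrite !upd_lt by lia.
    + rewrite tr_eq, E, upd_lt, upd_same by lia. reflexivity.
  - split.
    + intros (a & Ha & K). replace c with a; [exact K|].
      symmetry. now apply Ha.
    + intros K. exists c. split; [reflexivity|exact K].
Qed.

Lemma denotes_on1 k e f t a c : graph1 f a c -> denotes k e t a ->
  denotes k e (on1 f t) c.
Proof.
  intros F H k' e' v L E Hv. unfold on1.
  rewrite (tr_desc k' e' t a) by (eapply denotes_mono; eassumption).
  rewrite (F (S k') _ k' v); [|lia|lia|apply upd_same].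
  now rewrite upd_lt by lia.
Qed.

Lemma denotes_on2 k e f s t a b c : graph2 f a b c ->
  denotes k e s a -> denotes k e t b -> denotes k e (on2 f s t) c.
Proof.
  intros F H H' k' e' v L E Hv. unfold on2.
  rewrite (tr_desc k' e' s a) by (eapply denotes_mono; eassumption).
  rewrite (tr_desc (S k') _ t b).
  2:{ apply denotes_upd. eapply denotes_mono; eassumption. }
  rewrite (F (S (S k')) _ k' (S k') v); try lia.
  - now rewrite !upd_lt by lia.
  - now rewrite upd_lt, upd_same by lia.
  - apply upd_same.
Qed.

Lemma denotes_on3 k e f r s t a b c d : graph3 f a b c d ->
  denotes k e r a -> denotes k e s b -> denotes k e t c ->
  denotes k e (on3 f r s t) d.
Proof.
  intros F H H' H'' k' e' v L E Hv. unfold on3.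
  rewrite (tr_desc k' e' r a) by (eapply denotes_mono; eassumption).
  rewrite (tr_desc (S k') _ s b).
  2:{ apply denotes_upd. eapply denotes_mono; eassumption. }
  rewrite (tr_desc (S (S k')) _ t c).
  2:{ apply denotes_upd, denotes_upd. eapply denotes_mono; eassumption. }
  rewrite (F (S (S (S k'))) _ k' (S k') (S (S k')) v); try lia.
  - now rewrite !upd_lt by lia.
  - now rewrite !upd_lt, upd_same by lia.
  - now rewrite upd_lt, upd_same by lia.
  - apply upd_same.
Qed.

Lemma tr_tMem k e t c i : denotes k e t c -> i < k ->
  (tr M e (tMem t i k) <-> tin c (e i)).
Proof.
  intros H Hi. unfold tMem. rewrite (tr_desc k e t c _ H).
  rewrite tr_mem, upd_same, upd_lt by exact Hi. reflexivity.
Qed.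

Lemma tr_tEq k e s t a b : denotes k e s a -> denotes k e t b ->
  (tr M e (tEq s t k) <-> a = b).
Proof.
  intros H H'. unfold tEq. rewrite (tr_desc k e s a _ H).
  rewrite (tr_desc (S k) _ t b) by now apply denotes_upd.
  rewrite tr_eq, upd_same, upd_lt, upd_same by lia. reflexivity.
Qed.

(** Besides truth, the falsity of the defining formula must be evaluated here, since the [⇔] in
    [setof] prescribes both conditions of the set. *)
Lemma tr_setof k e v (p : nat -> fm) P Q : v < k -> is_set P Q ->
  (forall a, (tr M (upd e k a) (p k (S k)) <-> P a)
          /\ (fa M (upd e k a) (p k (S k)) <-> ~ Q a)) ->
  (tr M e (setof p v k) <-> e v = mk P Q).
Proof.
  intros Hv S H. rewrite (mk_unique _ _ _ S). apply tr_all. intros a.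
  destruct (H a) as [H1 H2].
  transitivity
    ((tin (upd e k a k) (upd e k a v) <-> tr M (upd e k a) (p k (Datatypes.S k)))
    /\ (memF M (upd e k a k) (upd e k a v) <-> fa M (upd e k a) (p k (Datatypes.S k))));
    [reflexivity|].
  rewrite upd_same, upd_lt, memF_qin, H1, H2 by exact Hv.
  assert (K : (~ qin a (e v) <-> ~ Q a) <-> (qin a (e v) <-> Q a)) by tauto.
  now rewrite K.
Qed.

Ltac upds := repeat first [rewrite upd_same | rewrite upd_lt by lia].

Ltac setof_eval :=
  apply tr_setof; [assumption|idtac|];
  [ | let x := fresh "x" in intros x;
      cbn -[upd]; upds; rewrite ?memF_qin; fold tin; try tauto ].

Lemma graph_bang a : graph1 bang a (bng a).
Proof. intros k e i v Hi Hv <-. setof_eval. apply bng_set. Qed.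

Lemma graph_quest a : graph1 quest a (qst a).
Proof. intros k e i v Hi Hv <-. setof_eval. apply qst_set. Qed.

Lemma graph_singleton a : graph1 singleton a (sing a).
Proof. intros k e i v Hi Hv <-. setof_eval. apply sing_set. Qed.

Lemma graph_upair a b : graph2 upair a b (upr a b).
Proof. intros k e i j v Hi Hj Hv <- <-. setof_eval. apply upr_set. Qed.

Lemma graph_union a b : graph2 union a b (cup a b).
Proof. intros k e i j v Hi Hj Hv <- <-. setof_eval. apply cup_set. Qed.

Lemma graph_inter a b : graph2 inter a b (cap a b).
Proof. intros k e i j v Hi Hj Hv <- <-. setof_eval. apply cap_set. Qed.

Lemma graph_diff a b : graph2 diff a b (dif a b).
Proof. intros k e i j v Hi Hj Hv <- <-. setof_eval. apply dif_set. Qed.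

Lemma denotes_empty k e : denotes k e empty emp.
Proof. intros k' e' v L E Hv. setof_eval. apply emp_set. Qed.

Lemma denotes_one k e : denotes k e Defs.one one.
Proof. eapply denotes_on1; [apply graph_singleton|apply denotes_empty]. Qed.

Lemma graph_kpair a b : graph2 kpair a b (kp a b).
Proof.
  intros k e i j v Hi Hj Hv <- <-. apply denotes_at; [|exact Hv].
  eapply denotes_on2; [apply graph_upair| |].
  - apply (denotes_graph1 _ (e i)); auto using graph_singleton.
  - apply (denotes_graph2 _ (e i) (e j)); auto using graph_upair.
Qed.

Lemma graph_pair a b : graph2 pair a b (opair a b).
Proof.
  intros k e i j v Hi Hj Hv <- <-.
  apply tr_setof; [assumption|apply opair_set|]. intros x.
  assert (K : forall t c, (forall k e, denotes k e t c) -> forall u,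
    tr M (upd (upd e k x) (S k) u) (on2 kpair t (var (S k)) k (S (S k)))
      <-> x = kp c u).
  { intros t c H u.
    rewrite (denotes_at _ _ _ (kp c u)); [now upds| |lia].
    eapply denotes_on2; [apply graph_kpair|apply H|].
    replace u with (upd (upd e k x) (S k) u (S k)) at 2 by apply upd_same.
    apply denotes_var. lia. }
  pose proof (K zero emp denotes_empty) as K0.
  pose proof (K Defs.one one denotes_one) as K1.
  split.
  - apply tr_or; apply tr_ex; intros u; apply tr_and;
      try (rewrite tr_mem; now upds).
    + rewrite <- K0. simpl. tauto.
    + rewrite <- K1. simpl. tauto.
  (* [Bang] makes the equation with the tagged pair false exactly when it is not true; only [u ∈ a]
     and [u ∈ b] contribute a genuine falsity condition. *)
  - transitivity
      ((forall u,
        ~ tr M (upd (upd e k x) (S k) u) (on2 kpair zero (var (S k)) k (S (S k)))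
        \/ memF M (upd (upd e k x) (S k) u (S k)) (upd (upd e k x) (S k) u i)) /\
       (forall u,
        ~ tr M (upd (upd e k x) (S k) u) (on2 kpair Defs.one (var (S k)) k (S (S k)))
        \/ memF M (upd (upd e k x) (S k) u (S k)) (upd (upd e k x) (S k) u j)));
      [reflexivity|].
    split.
    + intros [H H'] [[u [E N]]|[u [E N]]].
      * specialize (H u). rewrite K0, memF_qin in H. revert H. upds. tauto.
      * specialize (H' u). rewrite K1, memF_qin in H'. revert H'. upds. tauto.
    + intros H. split; intros u; rewrite ?K0, ?K1, memF_qin; upds;
        apply NNPP; intros N; apply H; [left|right]; exists u; tauto.
Qed.

Lemma tr_pair k e i j v : i < k -> j < k -> v < k ->
  (tr M e (pair i j v k) <-> e v = opair (e i) (e j)).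
Proof. intros Hi Hj Hv. now apply graph_pair. Qed.

Lemma tr_tMem_pair k e i j l : i < k -> j < k -> l < k ->
  (tr M e (tMem (pair i j) l k) <-> tin (opair (e i) (e j)) (e l)).
Proof.
  intros Hi Hj Hl. apply tr_tMem; [|exact Hl].
  apply (denotes_graph2 _ (e i) (e j)); auto using graph_pair.
Qed.

Lemma graph_triple a b c : graph3 triple a b c (opair (opair a b) c).
Proof.
  intros k e i j l v Hi Hj Hl Hv <- <- <-. apply denotes_at; [|exact Hv].
  eapply denotes_on2; [apply graph_pair| |now apply denotes_var].
  apply (denotes_graph2 _ (e i) (e j)); auto using graph_pair.
Qed.

Lemma graph_prod a b : graph2 prod a b (prd a b).
Proof.
  intros k e i j v Hi Hj Hv <- <-.
  apply tr_setof; [assumption|apply prd_set|]. intros z.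
  set (E := fun x y => upd (upd (upd e k z) (S k) x) (S (S k)) y).
  assert (K : forall x y,
    tr M (E x y) (pair (S k) (S (S k)) k (S (S (S k)))) <-> z = opair x y).
  { intros x y. unfold E. rewrite tr_pair by lia. now upds. }
  split.
  - apply tr_ex. intros x. apply tr_ex. intros y. apply tr_and.
    + rewrite <- K. simpl. tauto.
    + apply tr_and; rewrite tr_mem; now upds.
  - transitivity (forall x y,
      ~ tr M (E x y) (pair (S k) (S (S k)) k (S (S (S k))))
      \/ memF M (E x y (S k)) (E x y i) \/ memF M (E x y (S (S k))) (E x y j));
      [reflexivity|].
    split.
    + intros H (x & y & -> & N). specialize (H x y).
      rewrite K, !memF_qin in H. revert H. unfold E. upds. tauto.
    + intros H x y. rewrite K, !memF_qin. unfold E. upds.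
      apply NNPP. intros N. apply H. exists x, y. tauto.
Qed.

Lemma graph_tagged a b : graph2 tagged a b (tgd a b).
Proof.
  intros k e i j v Hi Hj Hv <- <-.
  apply tr_setof; [assumption|apply tgd_set|]. intros z.
  set (E := fun x => upd (upd e k z) (S k) x).
  assert (K : forall x,
    tr M (E x) (pair (S k) j k (S (S k))) <-> z = opair x (e j)).
  { intros x. unfold E. rewrite tr_pair by lia. now upds. }
  split.
  - apply tr_ex. intros x. apply tr_and.
    + rewrite <- K. simpl. tauto.
    + rewrite tr_mem; now upds.
  - transitivity (forall x,
      ~ tr M (E x) (pair (S k) j k (S (S k)))
      \/ memF M (E x (S k)) (E x i));
      [reflexivity|].
    split.
    + intros H (x & -> & N). specialize (H x).
      rewrite K, !memF_qin in H. revert H. unfold E. upds. tauto.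
    + intros H x. rewrite K, !memF_qin. unfold E. upds.
      apply NNPP. intros N. apply H. exists x. tauto.
Qed.

Lemma graph_dsum a b : graph2 dsum a b (dsm a b).
Proof.
  intros k e i j v Hi Hj Hv <- <-. apply denotes_at; [|exact Hv].
  eapply denotes_on2; [apply graph_union| |];
    (eapply denotes_on2; [apply graph_tagged|now apply denotes_var|]);
    [apply denotes_empty|apply denotes_one].
Qed.

Lemma graph_part_b a : graph1 part_b a (dif (bng a) (qst a)).
Proof.
  intros k e i v Hi Hv <-. apply denotes_at; [|exact Hv].
  eapply denotes_on2; [apply graph_diff| |]; (eapply denotes_graph1;
    [apply graph_bang || apply graph_quest|exact Hi|reflexivity]).
Qed.

Lemma graph_part_t a : graph1 part_t a (cap (bng a) (qst a)).
Proof.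
  intros k e i v Hi Hv <-. apply denotes_at; [|exact Hv].
  eapply denotes_on2; [apply graph_inter| |]; (eapply denotes_graph1;
    [apply graph_bang || apply graph_quest|exact Hi|reflexivity]).
Qed.

Lemma graph_part_n a : graph1 part_n a (dif (qst a) (bng a)).
Proof.
  intros k e i v Hi Hv <-. apply denotes_at; [|exact Hv].
  eapply denotes_on2; [apply graph_diff| |]; (eapply denotes_graph1;
    [apply graph_bang || apply graph_quest|exact Hi|reflexivity]).
Qed.

Lemma tr_classical k e i : i < k -> (tr M e (classical i k) <-> Class (e i)).
Proof.
  intros Hi. apply tr_all. intros a. cbn -[upd]. upds.
  unfold tin, qin. tauto.
Qed.

Lemma tr_subset k e i j : i < k -> j < k ->
  (tr M e (subset i j k) <-> Sub (e i) (e j)).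
Proof.
  intros Hi Hj. apply tr_all. intros a. cbn -[upd]. upds.
  rewrite !memF_qin. fold tin. tauto.
Qed.

(** Here [=] is evaluated for falsity, about which a model says little by itself. The falsity half
    of Extensionality gives an element true in one set and false in the other; as membership in the
    empty set is always false and never true, it is a true member of [e i]. *)
Lemma tr_nonempty k e i : i < k ->
  (tr M e (nonempty i k) <-> exists x, tin x (e i)).
Proof.
  intros Hi. unfold nonempty. rewrite (tr_desc k e _ emp _ (denotes_empty k e)).
  cbn -[upd]. upds.
  destruct (HM _ ax_extensionality e (e i) emp) as [_ H]. cbn in H.
  rewrite H. split.
  - intros [x K]. exists x. rewrite !memF_qin in K.
    pose proof (not_tin_emp x). unfold tin in *. tauto.
  - intros [x K]. exists x. rewrite !memF_qin.
    pose proof (not_qin_emp x). unfold tin in *. tauto.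
Qed.

Ltac tr_eval :=
  cbv beta;
  lazymatch goal with
  | |- tr _ _ (fAll _ _) <-> _ => apply tr_all; intro; tr_eval
  | |- tr _ _ (fEx _ _) <-> _ => apply tr_ex; intro; tr_eval
  | |- tr _ _ (fAnd _ _ _) <-> _ => apply tr_and; tr_eval
  | |- tr _ _ (fOr _ _ _) <-> _ => apply tr_or; tr_eval
  | |- tr _ _ (fImp _ _ _) <-> _ => apply tr_imp; tr_eval
  | |- tr _ _ (fIff _ _ _) <-> _ => apply tr_iff; tr_eval
  | |- tr _ _ (fNot _ _) <-> _ => apply tr_not; tr_eval
  | |- tr _ _ (all_in _ _ _) <-> _ =>
      apply tr_all_in; [lia|upds; reflexivity|intro; tr_eval]
  | |- tr _ _ (ex_in _ _ _) <-> _ =>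
      apply tr_ex_in; [lia|upds; reflexivity|intro; tr_eval]
  | |- tr _ _ (fMem _ _ _) <-> _ => rewrite tr_mem; upds; reflexivity
  | |- tr _ _ (fEq _ _ _) <-> _ => rewrite tr_eq; upds; reflexivity
  | |- tr _ _ (classical _ _) <-> _ =>
      rewrite tr_classical by lia; upds; reflexivity
  | |- tr _ _ (subset _ _ _) <-> _ =>
      rewrite tr_subset by lia; upds; reflexivity
  | |- tr _ _ (nonempty _ _) <-> _ =>
      rewrite tr_nonempty by lia; upds; reflexivity
  | |- tr _ _ (pair _ _ _ _) <-> _ =>
      rewrite tr_pair by lia; upds; reflexivity
  | |- tr _ _ (tMem (pair ?x ?y) _ _) <-> _ =>
      rewrite tr_tMem_pair by lia; upds; reflexivity
  end.

Lemma tr_ordinal k e i : i < k -> (tr M e (ordinal i k) <-> Ord (e i)).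
Proof. intros Hi. unfold ordinal, Ord. tr_eval. Qed.

Lemma tr_function_on k e i j : i < k -> j < k ->
  (tr M e (function_on i j k) <-> Fun (e i) (e j)).
Proof. intros Hi Hj. unfold function_on, Fun. tr_eval. Qed.

Lemma tr_equinumerous k e i j : i < k -> j < k ->
  (tr M e (equinumerous i j k) <-> Equi (e i) (e j)).
Proof.
  intros Hi Hj. apply tr_ex. intros f. unfold bijection, Bij.
  apply tr_and; [|tr_eval].
  rewrite tr_function_on by lia. upds. reflexivity.
Qed.

Lemma choice_function X : Class X -> (forall A, tin A X -> exists x, tin x A) ->
  exists f, Fun f X /\ forall A, tin A X -> exists y, tin y A /\ tin (opair A y) f.
Proof.
  intros HX HA.
  pose proof (HM _ ax_choice (fun _ => X)) as H.
  assert (K : tr M (fun _ => X) (choice 0) <-> forall X : M,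
    Class X /\ (forall A, tin A X -> exists x, tin x A) ->
    exists f, Fun f X /\
      forall A, tin A X -> exists y, tin y A /\ tin (opair A y) f).
  { unfold choice. apply tr_all. intros Y. apply tr_imp; [tr_eval|].
    apply tr_ex. intros f. apply tr_and; [|tr_eval].
    rewrite tr_function_on by lia. upds. reflexivity. }
  exact (proj1 K H X (conj HX HA)).
Qed.

(** * The numeration theorem *)

Section Enumeration.
(** [g] chooses an element from each non-empty classical subset of [X]. *)
Variables (X g : M).
Hypothesis g_value : forall S y, tin (opair S y) g -> tin y S.
Hypothesis g_unique : forall S y y',
  tin (opair S y) g -> tin (opair S y') g -> y = y'.
Hypothesis g_total : forall S, Class S -> (forall x, tin x S -> tin x X) ->
  (exists x, tin x S) -> exists y, tin (opair S y) g.

(** [f] is a set of pairs [(b,x)], read as [x] being the element picked at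
    stage [b]. *)
Definition next f a y : Prop :=
  exists S, Class S
    /\ (forall x, tin x S <-> tin x X /\ forall b, tin b a -> ~ tin (opair b x) f)
    /\ tin (opair S y) g.

(** [f] approximates the recursion below [a] and is unconstrained at other stages. When [X] is
    exhausted, [g] offers nothing to pick, so [f] has no pair at that stage. *)
Definition enumerates f a : Prop :=
  forall b, tin b a -> forall y, tin (opair b y) f <-> next f b y.

Lemma next_agree f h a y :
  (forall b, tin b a -> forall x, tin (opair b x) f <-> tin (opair b x) h) ->
  next f a y <-> next h a y.
Proof.
  intros H. split; intros (S & HS & K & Hy); exists S; (split; [exact HS|]);
    (split; [|exact Hy]); intros x; rewrite K; split; intros [Hx N];
    (split; [exact Hx|]); intros b Hb; specialize (N b Hb);
    specialize (H b Hb x); tauto.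
Qed.

(** At the least stage of disagreement both approximations have used up the same elements, so they
    pick alike. *)
Lemma enumerates_agree f h a b : Ord a -> Ord b ->
  enumerates f a -> enumerates h b -> forall c, tin c a -> tin c b ->
  forall y, tin (opair c y) f <-> tin (opair c y) h.
Proof.
  intros Ha Hb F H. apply NNPP. intros N.
  destruct (Ord_min a (fun c => tin c b /\
    ~ forall y, tin (opair c y) f <-> tin (opair c y) h))
    as (m & Hma & (Hmb & Hm) & K); [dfn|exact Ha| |].
  { apply NNPP. intros N'. apply N. intros c Hca Hcb. apply NNPP.
    intros N2. apply N'. now exists c. }
  apply Hm. intros y. rewrite (F m Hma), (H m Hmb). apply next_agree.
  intros c Hc. apply NNPP. intros N'. apply (K c); eauto using Ord_trans.
Qed.

Lemma enumerates_mono f a b : Ord a -> tin b a -> enumerates f a -> enumerates f b.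
Proof. intros Ha Hb F c Hc. apply F. eauto using Ord_trans. Qed.

(** The result of the recursion as an explicit formula: some approximation up to [a] picks [y] next.
    By [enumerates_agree] the choice of the approximation is immaterial. *)
Definition nth_elem a y : Prop := exists f, enumerates f a /\ next f a y.

Lemma nth_elem_next f a y : Ord a -> enumerates f a ->
  (nth_elem a y <-> next f a y).
Proof.
  intros Ha F. split.
  - intros (h & H & K). revert K. apply next_agree. intros b Hb.
    now apply (enumerates_agree f h a a).
  - intros K. now exists f.
Qed.

Lemma nth_elem_dfn : Dfn2 nth_elem.
Proof. unfold Dfn2, nth_elem, enumerates, next. dfn. Qed.

Lemma next_in f a y : next f a y -> tin y X /\ forall b, tin b a -> ~ tin (opair b y) f.
Proof. intros (S & _ & K & Hy). apply K. now apply g_value. Qed.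

(** At a least counterexample [m], every earlier stage has an approximation, so [nth_elem] below [m]
    is the recursion as it should be; its graph, a set bounded by [m] times [X], is an approximation
    up to [m]. *)
Lemma enumeration_exists a : Ord a -> exists f, enumerates f a.
Proof.
  intros Ha. apply NNPP. intros N.
  destruct (Ord_least (fun a => ~ exists f, enumerates f a))
    as (m & Om & Hm & K).
  { unfold enumerates, next. dfn. }
  { eauto. }
  assert (IH : forall b, tin b m -> exists f, enumerates f b).
  { intros b Hb. apply NNPP. intros N'.
    destruct (K b (Ord_elem m b Om Hb) N') as [->|E].
    - exact (Ord_irrefl b Om Hb).
    - apply (Ord_irrefl m Om). now apply (Ord_trans m b). }
  set (P := fun z => exists b y, z = opair b y /\ (tin b m /\ (tin y X /\ nth_elem b y))).
  assert (S : is_set P P).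
  { apply is_set_class.
    - unfold P. pose proof nth_elem_dfn. dfn.
    - apply bounded_sub with
        (Q := fun z => exists b y, z = opair b y /\ (tin b m /\ tin y X)).
      + intros z (b & y & L). exists b, y. tauto.
      + apply bounded_image2; apply bounded_tin || apply opair_dfn. }
  assert (I : forall b y, tin (opair b y) (mk P P) <-> tin b m /\ tin y X /\ nth_elem b y).
  { intros b y. destruct (mkE _ _ S (opair b y)) as [-> _]. split.
    - intros (b' & y' & E & L). apply opair_inj in E as [-> ->]. exact L.
    - intros L. now exists b, y. }
  apply Hm. exists (mk P P). intros b Hb y.
  destruct (IH b Hb) as [f F].
  assert (Ob : Ord b) by now apply (Ord_elem m).
  rewrite I, (nth_elem_next f b y Ob F).
  rewrite <- (next_agree f (mk P P) b y).
  - split; [tauto|]. intros L. split; [exact Hb|]. split; [|exact L].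
    now apply next_in in L.
  - intros c Hc x.
    assert (Oc : Ord c) by now apply (Ord_elem b).
    rewrite I, (F c Hc x).
    rewrite (nth_elem_next f c x Oc (enumerates_mono f b c Ob Hc F)).
    split; [|tauto]. intros L.
    split; [now apply (Ord_trans m b)|]. split; [|exact L].
    now apply next_in in L.
Qed.

(** The recursion equation with approximations eliminated; all later facts about the picks are
    derived from it. *)
Lemma nth_elem_spec a y : Ord a ->
  (nth_elem a y <-> exists S, Class S
    /\ (forall x, tin x S <-> tin x X /\ forall b, tin b a -> ~ nth_elem b x)
    /\ tin (opair S y) g).
Proof.
  intros Oa. destruct (enumeration_exists a Oa) as [f F].
  rewrite (nth_elem_next f a y Oa F). unfold next.
  assert (E : forall b, tin b a -> forall x, tin (opair b x) f <-> nth_elem b x).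
  { intros b Hb x. rewrite (F b Hb x). symmetry. apply nth_elem_next.
    - now apply (Ord_elem a).
    - now apply (enumerates_mono f a b). }
  split; intros (S & HS & K & Hy); exists S; (split; [exact HS|]);
    (split; [|exact Hy]); intros x; rewrite K; split; intros [Hx N];
    (split; [exact Hx|]); intros b Hb; specialize (N b Hb);
    specialize (E b Hb x); tauto.
Qed.

Lemma nth_elem_in a y : Ord a -> nth_elem a y ->
  tin y X /\ forall b, tin b a -> ~ nth_elem b y.
Proof.
  intros Oa H. apply nth_elem_spec in H as (S & _ & K & Hy); [|exact Oa].
  apply K. now apply g_value.
Qed.

Lemma nth_elem_unique a y y' : Ord a -> nth_elem a y -> nth_elem a y' -> y = y'.
Proof.
  intros Oa H H'. apply nth_elem_spec in H as (S & C & K & Hy); [|exact Oa].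
  apply nth_elem_spec in H' as (S' & C' & K' & Hy'); [|exact Oa].
  replace S' with S in Hy'; [now apply (g_unique S)|].
  apply Class_ext; auto. intros x. now rewrite K, K'.
Qed.

Lemma nth_elem_inj a b y : Ord a -> Ord b ->
  nth_elem a y -> nth_elem b y -> a = b.
Proof.
  intros Oa Ob H H'. destruct (Ord_tricho a b Oa Ob) as [K|[K|K]].
  - destruct (nth_elem_in b y Ob H') as [_ N]. now destruct (N a K).
  - exact K.
  - destruct (nth_elem_in a y Oa H) as [_ N]. now destruct (N b K).
Qed.

Lemma enumeration_theorem : exists a, Ord a /\ Equi X a.
Proof.
  assert (E : exists a, Ord a /\ ~ exists y, nth_elem a y).
  { apply NNPP. intros N. apply Ord_unbounded.
    apply bounded_sub with
      (Q := fun a => exists y, tin y X /\ (Ord a /\ nth_elem a y)).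
    - intros a Oa. apply NNPP. intros N'. apply N. exists a. split; [exact Oa|].
      intros [y Hy]. apply N'. exists y.
      destruct (nth_elem_in a y Oa Hy). auto.
    - apply (bounded_rel _ (fun y a => Ord a /\ nth_elem a y)).
      + pose proof nth_elem_dfn. dfn.
      + intros y a b [Oa H] [Ob H']. now apply (nth_elem_inj a b y).
      + apply bounded_tin. }
  (* At the least stage [a] without a pick, all earlier stages have one, so the picks are indexed
     exactly by the elements of [a]. *)
  apply (Ord_least (fun a => ~ exists y, nth_elem a y)) in E.
  2:{ pose proof nth_elem_dfn. dfn. }
  destruct E as (a & Oa & N & K). exists a. split; [exact Oa|].
  apply (Equi_intro (fun y b => nth_elem b y)).
  { pose proof nth_elem_dfn. dfn. }
  split; [|split; [|split]].
  - intros x Hx. apply NNPP. intros N'.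
    set (P := fun x => tin x X /\ forall b, tin b a -> ~ nth_elem b x).
    assert (S : is_set P P).
    { apply is_set_class.
      - unfold P. pose proof nth_elem_dfn. dfn.
      - apply bounded_sub with (Q := fun z => tin z X); [unfold P; tauto|].
        apply bounded_tin. }
    destruct (g_total (mk P P)) as [y Hy].
    + intros z. destruct (mkE _ _ S z) as [H1 H2]. now rewrite H1, H2.
    + intros z Hz. now apply (mkE _ _ S z) in Hz as [Hz _].
    + exists x. apply (mkE _ _ S x). split; [exact Hx|].
      intros b Hb Hbx. eauto.
    + apply N. exists y. apply nth_elem_spec; [exact Oa|].
      exists (mk P P). split; [|split; [|exact Hy]].
      * intros z. destruct (mkE _ _ S z) as [H1 H2]. now rewrite H1, H2.
      * intros z. now destruct (mkE _ _ S z) as [H1 H2].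
  - intros b Hb. assert (Ob : Ord b) by now apply (Ord_elem a).
    destruct (classic (exists y, nth_elem b y)) as [[y Hy]|N'].
    + exists y. split; [|exact Hy]. now apply (nth_elem_in b).
    + destruct (K b Ob N') as [->|H].
      * destruct (Ord_irrefl b Ob Hb).
      * destruct (Ord_irrefl a Oa). now apply (Ord_trans a b).
  - intros x b b' _ Hb Hb' H H'.
    apply (nth_elem_inj b b' x); auto; now apply (Ord_elem a).
  - intros x x' b _ _ Hb H H'. apply (nth_elem_unique b); auto.
    now apply (Ord_elem a).
Qed.

End Enumeration.

Lemma numeration X : exists a, Ord a /\ Equi X a.
Proof.
  (* Choice is applied to the set of non-empty classical sets of true members of [X], which the
     power set bounds. *)
  set (P := fun S => Class S /\ (forall x, tin x S -> tin x X) /\ exists x, tin x S).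
  assert (S : is_set P P).
  { apply is_set_class.
    - unfold P. dfn.
    - eapply bounded_sub; [|apply (bounded_pow X)]. unfold P. tauto. }
  destruct (choice_function (mk P P)) as (g & (_ & G1 & G2) & G3).
  - intros z. destruct (mkE _ _ S z) as [H1 H2]. now rewrite H1, H2.
  - intros z Hz. apply (mkE _ _ S z) in Hz. apply Hz.
  - assert (D : forall A y, tin (opair A y) g -> tin A (mk P P)).
    { intros A y H. destruct (G1 _ H) as (A' & HA & y' & E).
      apply opair_inj in E as [-> _]. exact HA. }
    assert (U : forall A y y', tin (opair A y) g -> tin (opair A y') g -> y = y').
    { intros A y y' H H'. destruct (G2 A (D A y H)) as [w W].
      apply W in H, H'. congruence. }
    apply (enumeration_theorem X g).
    + intros A y H. destruct (G3 A (D A y H)) as (w & Hw & W).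
      now rewrite (U A y w H W).
    + exact U.
    + intros A H1 H2 H3. destruct (G3 A) as (w & _ & W); [|eauto].
      apply (mkE _ _ S A). unfold P. auto.
Qed.

(** * Cardinals of classical sets *)

Definition is_clcard X a : Prop :=
  Ord a /\ Equi X a /\ forall b, Ord b /\ Equi X b -> a = b \/ tin a b.

Definition ClCard X : M := epsilon (dom_inhabited M) (is_clcard X).

Lemma is_clcard_ClCard X : is_clcard X (ClCard X).
Proof.
  apply (epsilon_spec (dom_inhabited M) (is_clcard X)).
  destruct (Ord_least (fun a => Equi X a)) as (a & H1 & H2 & H3).
  - dfn.
  - apply numeration.
  - exists a. split; [exact H1|]. split; [exact H2|]. intros b [Ob Hb]. auto.
Qed.

Lemma is_clcard_unique X a b : is_clcard X a -> is_clcard X b -> a = b.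
Proof.
  intros (H1 & H2 & H3) (H1' & H2' & H3').
  destruct (H3 b) as [E|E]; [tauto|exact E|].
  destruct (H3' a) as [E'|E']; [tauto|now symmetry|].
  destruct (Ord_irrefl a H1). now apply (Ord_trans a b).
Qed.

Lemma ClCard_eq X Y : ClCard X = ClCard Y <-> Equi X Y.
Proof.
  destruct (is_clcard_ClCard X) as (H1 & H2 & H3).
  pose proof (is_clcard_ClCard Y) as H'. destruct H' as (H1' & H2' & H3').
  split.
  - intros E. apply (Equi_trans X (ClCard X) Y); [exact H2|].
    rewrite E. now apply Equi_sym.
  - intros E. apply (is_clcard_unique Y); [|now apply is_clcard_ClCard].
    split; [exact H1|]. split.
    + apply (Equi_trans _ X); [now apply Equi_sym|exact H2].
    + intros b [Ob Hb]. apply H3. split; [exact Ob|].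
      now apply (Equi_trans _ Y).
Qed.

Lemma bijective_restrict (R : M -> M -> Prop) (P Q P' Q' : M -> Prop) :
  bijective_rel R P Q -> (forall x, P' x -> P x) -> (forall y, Q' y -> Q y) ->
  (forall x y, P x -> Q y -> R x y -> (P' x <-> Q' y)) -> bijective_rel R P' Q'.
Proof.
  intros (H1 & H2 & H3 & H4) HP HQ H. split; [|split; [|split]].
  - intros x Hx. destruct (H1 x) as (y & Hy & K); auto.
    exists y. split; [|exact K]. apply (H x y); auto.
  - intros y Hy. destruct (H2 y) as (x & Hx & K); auto.
    exists x. split; [|exact K]. apply (H x y); auto.
  - intros. apply (H3 x); auto.
  - intros. apply (H4 x x' y); auto.
Qed.

Lemma bijective_or (R R' : M -> M -> Prop) (P P' Q Q' : M -> Prop) :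
  bijective_rel R P Q -> bijective_rel R' P' Q' ->
  (forall x, P x -> P' x -> False) -> (forall y, Q y -> Q' y -> False) ->
  bijective_rel
    (fun x y => (P x /\ Q y /\ R x y) \/ (P' x /\ Q' y /\ R' x y))
    (fun x => P x \/ P' x) (fun y => Q y \/ Q' y).
Proof.
  intros (H1 & H2 & H3 & H4) (H1' & H2' & H3' & H4') D D'.
  split; [|split; [|split]].
  - intros x [Hx|Hx]; [destruct (H1 x Hx) as (y & Hy & K)
      |destruct (H1' x Hx) as (y & Hy & K)]; exists y; tauto.
  - intros y [Hy|Hy]; [destruct (H2 y Hy) as (x & Hx & K)
      |destruct (H2' y Hy) as (x & Hx & K)]; exists x; tauto.
  - intros x y y' _ _ _ [(A & B & K)|(A & B & K)] [(A' & B' & K')|(A' & B' & K')];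
      solve [eauto|destruct (D x); assumption].
  - intros x x' y _ _ _ [(A & B & K)|(A & B & K)] [(A' & B' & K')|(A' & B' & K')];
      solve [eauto|destruct (D' y); assumption].
Qed.

(** * Cardinal numbers *)

Definition pb A : M := dif (bng A) (qst A).
Definition pt A : M := cap (bng A) (qst A).
Definition pn A : M := dif (qst A) (bng A).

Lemma bng_mem A x : (tin x (bng A) <-> tin x A) /\ (qin x (bng A) <-> tin x A).
Proof. apply (mkE _ _ (bng_set A)). Qed.

Lemma qst_mem A x : (tin x (qst A) <-> qin x A) /\ (qin x (qst A) <-> qin x A).
Proof. apply (mkE _ _ (qst_set A)). Qed.

Lemma mixd_mem A B x :
  (tin x (mixd A B) <-> tin x A) /\ (qin x (mixd A B) <-> qin x B).
Proof. apply (mkE _ _ (mixd_set A B)). Qed.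

Lemma pb_mem A x :
  (tin x (pb A) <-> tin x A /\ ~ qin x A) /\ (qin x (pb A) <-> tin x A /\ ~ qin x A).
Proof.
  destruct (mkE _ _ (dif_set (bng A) (qst A)) x).
  destruct (bng_mem A x), (qst_mem A x). unfold pb, dif. tauto.
Qed.

Lemma pt_mem A x :
  (tin x (pt A) <-> tin x A /\ qin x A) /\ (qin x (pt A) <-> tin x A /\ qin x A).
Proof.
  destruct (mkE _ _ (cap_set (bng A) (qst A)) x).
  destruct (bng_mem A x), (qst_mem A x). unfold pt, cap. tauto.
Qed.

Lemma pn_mem A x :
  (tin x (pn A) <-> ~ tin x A /\ qin x A) /\ (qin x (pn A) <-> ~ tin x A /\ qin x A).
Proof.
  destruct (mkE _ _ (dif_set (qst A) (bng A)) x).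
  destruct (bng_mem A x), (qst_mem A x). unfold pn, dif. tauto.
Qed.

Lemma tin_bng A x : tin x (bng A) <-> tin x A.
Proof. apply bng_mem. Qed.

Lemma tin_qst A x : tin x (qst A) <-> qin x A.
Proof. apply qst_mem. Qed.

Lemma tin_pb A x : tin x (pb A) <-> tin x A /\ ~ qin x A.
Proof. apply pb_mem. Qed.

Lemma tin_pt A x : tin x (pt A) <-> tin x A /\ qin x A.
Proof. apply pt_mem. Qed.

Lemma tin_pn A x : tin x (pn A) <-> ~ tin x A /\ qin x A.
Proof. apply pn_mem. Qed.

Lemma ClCard_Class X : Class (ClCard X).
Proof. destruct (is_clcard_ClCard X) as ((H & _) & _). exact H. Qed.

Lemma mixd_inj A B X Y : Class A -> Class B -> Class X -> Class Y ->
  mixd A B = mixd X Y -> A = X /\ B = Y.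
Proof.
  intros HA HB HX HY E. split; apply Class_ext; auto; intros x;
    destruct (mixd_mem A B x) as [H1 H2], (mixd_mem X Y x) as [H3 H4];
    rewrite E in H1, H2.
  - tauto.
  - rewrite (HB x), (HY x). tauto.
Qed.

Definition Card A : M :=
  opair (opair (mixd (ClCard (bng A)) (ClCard (qst A)))
               (mixd (ClCard (pt A)) (ClCard (qst A))))
        (mixd (ClCard (pb A)) (ClCard (pn A))).

(** Membership in the realm of [A]. *)
Definition live A x : Prop := tin x A \/ qin x A.

(** A bijection between the realms that preserves truth and falsity of
    membership. *)
Definition Iso A B : Prop := exists R, Dfn2 R
  /\ bijective_rel R (live A) (live B)
  /\ forall x y, live A x -> live B y -> R x y ->
       (tin x A <-> tin y B) /\ (qin x A <-> qin y B).

(** [A^!], [A^?], [A_b], [A_t] and [A_n] are all cut out of the realm by the status of membership,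
    so an isomorphism restricts to each of them; this gives the five equinumerosities of [Iso_Card]
    uniformly. *)
Lemma Iso_Equi A B X Y : Iso A B ->
  (forall x, tin x X -> live A x) -> (forall y, tin y Y -> live B y) ->
  (forall x y, (tin x A <-> tin y B) -> (qin x A <-> qin y B) ->
     (tin x X <-> tin y Y)) ->
  Equi X Y.
Proof.
  intros (R & HR & H & K) HX HY T. apply (Equi_intro R); [exact HR|].
  apply (bijective_restrict R (live A) (live B)); auto.
  intros x y Hx Hy Rxy. destruct (K x y Hx Hy Rxy). auto.
Qed.

Lemma Iso_Card A B : Iso A B -> Card A = Card B.
Proof.
  intros H. unfold Card.
  replace (ClCard (bng B)) with (ClCard (bng A)).
  replace (ClCard (qst B)) with (ClCard (qst A)).
  replace (ClCard (pt B)) with (ClCard (pt A)).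
  replace (ClCard (pb B)) with (ClCard (pb A)).
  replace (ClCard (pn B)) with (ClCard (pn A)).
  reflexivity.
  all: apply (proj2 (ClCard_eq _ _)), (Iso_Equi A B _ _ H); unfold live;
    intros x; rewrite ?tin_bng, ?tin_qst, ?tin_pb, ?tin_pt, ?tin_pn; try tauto;
    intros y; rewrite ?tin_bng, ?tin_qst, ?tin_pb, ?tin_pt, ?tin_pn; tauto.
Qed.

(** The second and third entries of the triple yield bijections of the t-, b- and n-parts, since
    [mixd] is injective on classical sets. These parts partition the realm, so the bijections can be
    glued. *)
Lemma Card_Iso A B : Card A = Card B -> Iso A B.
Proof.
  intros E. unfold Card in E. apply opair_inj in E as [E E3].
  apply opair_inj in E as [_ E2].
  apply mixd_inj in E2 as [Et _]; try apply ClCard_Class.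
  apply mixd_inj in E3 as [Eb En]; try apply ClCard_Class.
  apply ClCard_eq in Et, Eb, En.
  apply Equi_elim in Et as (R1 & D1 & B1).
  apply Equi_elim in Eb as (R2 & D2 & B2).
  apply Equi_elim in En as (R3 & D3 & B3).
  pose proof (bijective_or _ _ _ _ _ _ B1 B2) as B12.
  pose proof (bijective_or _ _ _ _ _ _ (B12
    ltac:(intros x; rewrite tin_pt, tin_pb; tauto)
    ltac:(intros x; rewrite tin_pt, tin_pb; tauto)) B3
    ltac:(intros x; simpl; rewrite tin_pt, tin_pb, tin_pn; tauto)
    ltac:(intros x; simpl; rewrite tin_pt, tin_pb, tin_pn; tauto)) as B123.
  match type of B123 with bijective_rel ?R _ _ => exists R end.
  split; [dfn|]. split.
  - apply (bijective_restrict _ _ _ _ _ B123); unfold live.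
    + intros x. rewrite tin_pt, tin_pb, tin_pn. tauto.
    + intros x. rewrite tin_pt, tin_pb, tin_pn. tauto.
    + intros x y _ _. rewrite !tin_pt, !tin_pb, !tin_pn. tauto.
  - intros x y _ _. rewrite !tin_pt, !tin_pb, !tin_pn. tauto.
Qed.

(** * Invariance of sums and products under isomorphism *)

Lemma live_dsm_left A B x : live (dsm A B) (opair x emp) <-> live A x.
Proof. destruct (dsm_left A B x) as [H H']. unfold live. now rewrite H, H'. Qed.

Lemma live_dsm_right A B x : live (dsm A B) (opair x one) <-> live B x.
Proof. destruct (dsm_right A B x) as [H H']. unfold live. now rewrite H, H'. Qed.

Lemma Iso_dsm A A' B B' : Iso A A' -> Iso B B' -> Iso (dsm A B) (dsm A' B').
Proof.
  intros (R & HR & (H1 & H2 & H3 & H4) & K) (R' & HR' & (H1' & H2' & H3' & H4') & K').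
  pose proof emp_one as N.
  exists (fun z w => (exists x y, z = opair x emp /\ w = opair y emp /\ R x y)
               \/ (exists x y, z = opair x one /\ w = opair y one /\ R' x y)).
  split; [dfn|]. split; [split; [|split; [|split]]|].
  - intros z Hz. destruct (dsm_inv A B z Hz) as [x [->| -> ] ].
    + apply live_dsm_left in Hz. destruct (H1 x Hz) as (y & Hy & Rxy).
      exists (opair y emp). rewrite live_dsm_left. split; [exact Hy|].
      left. eauto.
    + apply live_dsm_right in Hz. destruct (H1' x Hz) as (y & Hy & Rxy).
      exists (opair y one). rewrite live_dsm_right. split; [exact Hy|].
      right. eauto.
  - intros z Hz. destruct (dsm_inv A' B' z Hz) as [x [->| -> ] ].
    + apply live_dsm_left in Hz. destruct (H2 x Hz) as (y & Hy & Rxy).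
      exists (opair y emp). rewrite live_dsm_left. split; [exact Hy|].
      left. eauto.
    + apply live_dsm_right in Hz. destruct (H2' x Hz) as (y & Hy & Rxy).
      exists (opair y one). rewrite live_dsm_right. split; [exact Hy|].
      right. eauto.
  - intros z w w' Hz Hw Hw' [(x & y & -> & -> & L)|(x & y & -> & -> & L)]
      [(x' & y' & E & -> & L')|(x' & y' & E & -> & L')];
      apply opair_inj in E as [<- E]; try congruence; f_equal;
      rewrite ?live_dsm_left, ?live_dsm_right in *; eauto.
  - intros z w w' Hz Hw Hw' [(x & y & -> & -> & L)|(x & y & -> & -> & L)]
      [(x' & y' & -> & E & L')|(x' & y' & -> & E & L')];
      apply opair_inj in E as [<- E]; try congruence; f_equal;
      rewrite ?live_dsm_left, ?live_dsm_right in *; eauto.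
  - intros z w Hz Hw [(x & y & -> & -> & L)|(x & y & -> & -> & L)];
      rewrite ?live_dsm_left, ?live_dsm_right in *.
    + destruct (dsm_left A B x) as [-> ->], (dsm_left A' B' y) as [-> ->].
      auto.
    + destruct (dsm_right A B x) as [-> ->], (dsm_right A' B' y) as [-> ->].
      auto.
Qed.

(** The converse fails: for [x] in [A_b] and [y] in [B_n] the pair is neither a true nor a non-false
    member of the product. *)
Lemma live_prd A B x y : live (prd A B) (opair x y) -> live A x /\ live B y.
Proof.
  unfold live. rewrite (tin_prd), (qin_prd). tauto.
Qed.

Lemma Iso_prd A A' B B' : Iso A A' -> Iso B B' -> Iso (prd A B) (prd A' B').
Proof.
  intros (R & HR & (H1 & H2 & H3 & H4) & K) (R' & HR' & (H1' & H2' & H3' & H4') & K').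
  (* Since a pair of live elements need not be live, liveness of the image pair is obtained by
     transporting the status of the whole pair. *)
  assert (T : forall x x' y y', R x x' -> R' y y' -> live A x -> live A' x' ->
    live B y -> live B' y' ->
    (tin (opair x y) (prd A B) <-> tin (opair x' y') (prd A' B')) /\
    (qin (opair x y) (prd A B) <-> qin (opair x' y') (prd A' B'))).
  { intros x x' y y' L L' Hx Hx' Hy Hy'.
    rewrite !(tin_prd), !(qin_prd).
    destruct (K x x' Hx Hx' L) as [-> ->], (K' y y' Hy Hy' L') as [-> ->]. tauto. }
  exists (fun z w => exists x x' y y',
    z = opair x y /\ w = opair x' y' /\ R x x' /\ R' y y').
  split; [dfn|]. split; [split; [|split; [|split]]|].
  - intros z Hz. destruct (prd_inv A B z Hz) as (x & y & ->).
    destruct (live_prd A B x y Hz) as [Hx Hy].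
    destruct (H1 x Hx) as (x' & Hx' & L), (H1' y Hy) as (y' & Hy' & L').
    exists (opair x' y'). split; [|eauto 8].
    destruct (T x x' y y') as [T1 T2]; auto. unfold live in *. now rewrite <- T1, <- T2.
  - intros z Hz. destruct (prd_inv A' B' z Hz) as (x' & y' & ->).
    destruct (live_prd A' B' x' y' Hz) as [Hx' Hy'].
    destruct (H2 x' Hx') as (x & Hx & L), (H2' y' Hy') as (y & Hy & L').
    exists (opair x y). split; [|eauto 8].
    destruct (T x x' y y') as [T1 T2]; auto. unfold live in *. now rewrite T1, T2.
  - intros z w w' Hz Hw Hw' (x & x' & y & y' & -> & -> & L & L')
      (x2 & x2' & y2 & y2' & E & -> & L2 & L2').
    apply opair_inj in E as [<- <-].
    apply live_prd in Hz as [Hx Hy], Hw as [Hx' Hy'], Hw' as [Hx2' Hy2'].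
    f_equal; eauto.
  - intros z z' w Hz Hz' Hw (x & x' & y & y' & -> & -> & L & L')
      (x2 & x2' & y2 & y2' & -> & E & L2 & L2').
    apply opair_inj in E as [<- <-].
    apply live_prd in Hz as [Hx Hy], Hw as [Hx' Hy'], Hz' as [Hx2' Hy2'].
    f_equal; eauto.
  - intros z w Hz Hw (x & x' & y & y' & -> & -> & L & L').
    apply live_prd in Hz as [Hx Hy], Hw as [Hx' Hy']. auto.
Qed.

(** [⟨{∅}|∅|∅⟩] and [⟨∅|∅|{∅}⟩]. *)
Definition glut_unit : M := mixd (sing emp) emp.
Definition gap_unit : M := mixd emp (sing emp).

Lemma glut_unit_mem x : (tin x glut_unit <-> x = emp) /\ ~ qin x glut_unit.
Proof.
  destruct (mixd_mem (sing emp) emp x) as [H1 H2].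
  pose proof (tin_sing emp x). pose proof (not_qin_emp x).
  unfold glut_unit. tauto.
Qed.

Lemma gap_unit_mem x : ~ tin x gap_unit /\ (qin x gap_unit <-> x = emp).
Proof.
  destruct (mixd_mem emp (sing emp) x) as [H1 H2].
  destruct (mkE _ _ (sing_set emp) x) as [_ H3].
  pose proof (not_tin_emp x).
  unfold gap_unit. split; [tauto|]. rewrite H2. exact H3.
Qed.

(** [A_b] and [A_n] are classical, so the status their elements had in [A] is lost. A product takes
    conjunctions of statuses: the unit glut makes the pair with an element of [A_b] false as well as
    true, and the unit gap keeps the pair with an element of [A_n] from being true without making it
    false. *)
Lemma Iso_decomposition A :
  Iso A (dsm (dsm (pt A) (prd (pb A) glut_unit)) (prd (pn A) gap_unit)).
Proof.
  set (D := dsm (dsm (pt A) (prd (pb A) glut_unit)) (prd (pn A) gap_unit)).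
  pose proof emp_one as N.
  (* [MT], [MB] and [MN] give the status of the three shapes of elements in the nested sum; the tags
     are innermost first, with [emp] for left and [one] for right. *)
  assert (MT : forall x,
    (tin (opair (opair x emp) emp) D <-> tin x A /\ qin x A) /\
    (qin (opair (opair x emp) emp) D <-> tin x A /\ qin x A)).
  { intros x. unfold D. destruct (dsm_left (dsm (pt A) (prd (pb A) glut_unit))
      (prd (pn A) gap_unit) (opair x emp)) as [-> ->].
    destruct (dsm_left (pt A) (prd (pb A) glut_unit) x) as [-> ->].
    apply pt_mem. }
  assert (MB : forall x y,
    (tin (opair (opair (opair x y) one) emp) D <-> (tin x A /\ ~ qin x A) /\ y = emp) /\
    ~ qin (opair (opair (opair x y) one) emp) D).
  { intros x y. unfold D. destruct (dsm_left (dsm (pt A) (prd (pb A) glut_unit))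
      (prd (pn A) gap_unit) (opair (opair x y) one)) as [-> ->].
    destruct (dsm_right (pt A) (prd (pb A) glut_unit) (opair x y)) as [-> ->].
    rewrite (tin_prd), (qin_prd).
    destruct (glut_unit_mem y) as [-> ?], (pb_mem A x) as [-> ->]. tauto. }
  assert (MN : forall x y,
    ~ tin (opair (opair x y) one) D /\
    (qin (opair (opair x y) one) D <-> (~ tin x A /\ qin x A) /\ y = emp)).
  { intros x y. unfold D. destruct (dsm_right (dsm (pt A) (prd (pb A) glut_unit))
      (prd (pn A) gap_unit) (opair x y)) as [-> ->].
    rewrite (tin_prd), (qin_prd).
    destruct (gap_unit_mem y) as [? ->], (pn_mem A x) as [-> ->]. tauto. }
  assert (I : forall z, live D z -> exists x,
    z = opair (opair x emp) emp \/ (exists y, z = opair (opair (opair x y) one) emp)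
    \/ exists y, z = opair (opair x y) one).
  { intros z Hz. destruct (dsm_inv _ _ z Hz) as [w [->| -> ] ].
    - apply live_dsm_left in Hz. destruct (dsm_inv _ _ w Hz) as [u [->| -> ] ].
      + eauto.
      + apply live_dsm_right in Hz. destruct (prd_inv _ _ u Hz) as (x & y & ->).
        eauto.
    - apply live_dsm_right in Hz. destruct (prd_inv _ _ w Hz) as (x & y & ->).
      eauto. }
  (* [J1] separates the two shapes from the inner sum, [J2] separates both of them from the
     third. *)
  assert (J1 : forall x y, opair (opair x emp) emp <> opair (opair y one) emp).
  { intros x y E. apply opair_inj in E as [E _].
    now apply opair_inj in E as [_ E]. }
  assert (J2 : forall x y, opair x emp <> opair y one).
  { intros x y E. now apply opair_inj in E as [_ E]. }
  exists (fun x z =>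
    (tin x A /\ qin x A) /\ z = opair (opair x emp) emp
    \/ (tin x A /\ ~ qin x A) /\ z = opair (opair (opair x emp) one) emp
    \/ (~ tin x A /\ qin x A) /\ z = opair (opair x emp) one).
  split; [dfn|]. split; [split; [|split; [|split]]|].
  - unfold live. intros x Hx.
    destruct (classic (tin x A)) as [H|H], (classic (qin x A)) as [H'|H'].
    + exists (opair (opair x emp) emp). destruct (MT x). tauto.
    + exists (opair (opair (opair x emp) one) emp). destruct (MB x emp). tauto.
    + exists (opair (opair x emp) one). destruct (MN x emp). tauto.
    + tauto.
  - intros z Hz. destruct (I z Hz) as [x [-> | [[y ->] | [y ->] ] ] ];
      exists x; unfold live in *.
    + destruct (MT x). tauto.
    + destruct (MB x y) as [H H']. assert (y = emp) by tauto. subst y. tauto.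
    + destruct (MN x y) as [H H']. assert (y = emp) by tauto. subst y. tauto.
  - intros x z z' _ _ _ [[H ->]|[[H ->]|[H -> ] ] ] [[H' ->]|[[H' ->]|[H' -> ] ] ];
      tauto.
  - intros x x' z _ _ _ [[H ->]|[[H ->]|[H -> ] ] ] [[H' E]|[[H' E]|[H' E]]];
      try (now apply J1 in E); try (now apply J2 in E);
      try (symmetry in E; now apply J1 in E);
      try (symmetry in E; now apply J2 in E);
      repeat match goal with
      | K : opair _ _ = opair _ _ |- _ => apply opair_inj in K as [? _]
      end; assumption.
  - intros x z _ _ [[H ->]|[[H ->]|[H -> ] ] ].
    + destruct (MT x). tauto.
    + destruct (MB x emp). tauto.
    + destruct (MN x emp). tauto.
Qed.

(** * Values of the cardinal terms *)

Lemma graph_clcard X : Class X -> graph1 clcard X (ClCard X).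
Proof.
  intros HX k e i v Hi Hv E.
  transitivity (Class (e i) /\ is_clcard (e i) (e v)).
  - unfold clcard, is_clcard. apply tr_and; [now apply tr_classical|].
    apply tr_and; [now apply tr_ordinal|].
    apply tr_and; [now apply tr_equinumerous|].
    apply tr_all. intros b. apply tr_imp; [apply tr_and|].
    + rewrite (tr_ordinal), upd_same by lia. reflexivity.
    + rewrite (tr_equinumerous), upd_same, upd_lt by lia. reflexivity.
    + apply tr_or; [rewrite tr_eq|rewrite tr_mem];
        rewrite upd_same, upd_lt by lia; reflexivity.
  - rewrite E. pose proof (is_clcard_ClCard X). split.
    + intros [_ H']. now apply (is_clcard_unique X).
    + now intros ->.
Qed.

(** [X] and [Y] must equal [A^!] and [A^?], which are classical; this is where classicality of the
    arguments enters. *)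
Lemma graph_mix X Y : Class X -> Class Y -> graph2 mix X Y (mixd X Y).
Proof.
  intros HX HY k e i j v Hi Hj Hv Ei Ej.
  transitivity (e i = bng (e v) /\ e j = qst (e v)).
  - apply tr_and; [now apply graph_bang|now apply graph_quest].
  - rewrite Ei, Ej. split.
    + intros [E E']. apply set_ext; intros x;
        destruct (mixd_mem X Y x) as [H1 H2]; rewrite ?H1, ?H2.
      * rewrite E. destruct (bng_mem (e v) x). tauto.
      * rewrite E'. destruct (qst_mem (e v) x). tauto.
    + intros ->. split; apply set_ext; intros x; destruct (mixd_mem X Y x);
        destruct (bng_mem (mixd X Y) x), (qst_mem (mixd X Y) x);
        specialize (HX x); specialize (HY x); tauto.
Qed.

Lemma denotes_ClCard k e t X : Class X -> denotes k e t X ->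
  denotes k e (on1 clcard t) (ClCard X).
Proof. intros H. apply denotes_on1. now apply graph_clcard. Qed.

Lemma denotes_mix k e s t X Y : Class X -> Class Y ->
  denotes k e s X -> denotes k e t Y -> denotes k e (on2 mix s t) (mixd X Y).
Proof. intros H H'. apply denotes_on2. now apply graph_mix. Qed.

Lemma graph_card A : graph1 card A (Card A).
Proof.
  intros k e i v Hi Hv E. apply denotes_at; [|exact Hv].
  assert (Cb : Class (bng A)) by (intros x; destruct (bng_mem A x); tauto).
  assert (Cq : Class (qst A)) by (intros x; destruct (qst_mem A x); tauto).
  assert (Ct : Class (pt A)) by (intros x; destruct (pt_mem A x); tauto).
  assert (Cg : Class (pb A)) by (intros x; destruct (pb_mem A x); tauto).
  assert (Cn : Class (pn A)) by (intros x; destruct (pn_mem A x); tauto).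
  assert (G : forall f X, graph1 f A X -> denotes k e (f i) X)
    by (intros f X G; now apply (denotes_graph1 f A)).
  eapply denotes_on3; [apply graph_triple| | |];
    (apply denotes_mix; try apply ClCard_Class);
    (apply denotes_ClCard; [assumption|apply G]);
    first [ apply graph_bang | apply graph_quest
          | apply graph_part_t | apply graph_part_b
          | apply graph_part_n ].
Qed.

Lemma denotes_Card k e t A : denotes k e t A -> denotes k e (on1 card t) (Card A).
Proof. apply denotes_on1, graph_card. Qed.

Lemma tr_card k e i v : i < k -> v < k ->
  (tr M e (card i v k) <-> e v = Card (e i)).
Proof. intros Hi Hv. now apply graph_card. Qed.

(** Covers [cadd] and [cmul] at once. Any other representatives are isomorphic to [A] and [B] by
    [Card_Iso], so [HF] and [Iso_Card] give the same result and the description has a unique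
    value. *)
Lemma graph_cardinal_operation (f : nat -> nat -> tm) (F : M -> M -> M) A B :
  (forall a b, graph2 f a b (F a b)) ->
  (forall A A' B B', Iso A A' -> Iso B B' -> Iso (F A B) (F A' B')) ->
  graph2 (fun i j v => ∃ r s, card r i ∧ card s j ∧ on1 card (f r s) v)%bs4
    (Card A) (Card B) (Card (F A B)).
Proof.
  intros G HF k e i j v Hi Hj Hv Ei Ej.
  transitivity (exists A' B', Card A = Card A' /\ Card B = Card B'
    /\ e v = Card (F A' B')).
  - apply tr_ex. intros A'. apply tr_ex. intros B'.
    apply tr_and; [|apply tr_and].
    + rewrite tr_card by lia. rewrite !upd_lt, upd_same by lia. now rewrite Ei.
    + rewrite tr_card by lia. rewrite upd_same, !upd_lt by lia. now rewrite Ej.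
    + rewrite (denotes_at _ _ _ (Card (F A' B'))); [|apply denotes_Card|lia].
      * now rewrite !upd_lt by lia.
      * apply (denotes_graph2 f A' B'); [apply G|lia|lia| |apply upd_same].
        now rewrite upd_lt, upd_same by lia.
  - split.
    + intros (A' & B' & EA & EB & ->). symmetry.
      apply Iso_Card, HF; now apply Card_Iso.
    + intros ->. now exists A, B.
Qed.

Lemma graph_cadd A B : graph2 cadd (Card A) (Card B) (Card (dsm A B)).
Proof.
  apply (graph_cardinal_operation dsum dsm).
  - apply graph_dsum.
  - apply Iso_dsm.
Qed.

Lemma graph_cmul A B : graph2 cmul (Card A) (Card B) (Card (prd A B)).
Proof.
  apply (graph_cardinal_operation prod prd).
  - apply graph_prod.
  - apply Iso_prd.
Qed.

(** The three parts determine, for each [x], which of the four combinations of [tin] and [qin]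
    occurs, and hence determine [A]. *)
Lemma graph_mix3 A : graph3 mix3 (pb A) (pt A) (pn A) A.
Proof.
  intros k e i j l v Hi Hj Hl Hv Ei Ej El.
  transitivity (e i = pb (e v) /\ e j = pt (e v) /\ e l = pn (e v)).
  - apply tr_and; [now apply graph_part_b|].
    apply tr_and; [now apply graph_part_t|now apply graph_part_n].
  - rewrite Ei, Ej, El. split.
    + intros (E1 & E2 & E3). symmetry.
      assert (K : forall x, (tin x A /\ ~ qin x A <-> tin x (e v) /\ ~ qin x (e v))
        /\ (tin x A /\ qin x A <-> tin x (e v) /\ qin x (e v))
        /\ (~ tin x A /\ qin x A <-> ~ tin x (e v) /\ qin x (e v))).
      { intros x. rewrite <- !tin_pb, <- !tin_pt, <- !tin_pn, E1, E2, E3. tauto. }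
      apply set_ext; intros x; specialize (K x);
        destruct (classic (tin x A)), (classic (qin x A)); tauto.
    + now intros ->.
Qed.

Lemma denotes_sing_emp k e : denotes k e (on1 singleton empty) (sing emp).
Proof.
  eapply denotes_on1; [apply graph_singleton|apply denotes_empty].
Qed.

(** [frak_b] goes through [mix3] whereas [glut_unit] is a [mixd]; the link is that [glut_unit] has
    the parts [{∅}], [∅], [∅]. *)
Lemma denotes_frak_b k e : denotes k e frak_b (Card glut_unit).
Proof.
  apply denotes_Card. eapply denotes_on3; [apply graph_mix3| | |].
  - replace (pb glut_unit) with (sing (emp)); [apply denotes_sing_emp|].
    symmetry. apply (mk_unique _ _ _ (sing_set emp)). intros x.
    destruct (pb_mem glut_unit x) as [-> ->], (glut_unit_mem x). tauto.
  - replace (pt glut_unit) with (emp); [apply denotes_empty|].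
    symmetry. apply (mk_unique _ _ _ (emp_set)). intros x.
    destruct (pt_mem glut_unit x) as [-> ->], (glut_unit_mem x). tauto.
  - replace (pn glut_unit) with (emp); [apply denotes_empty|].
    symmetry. apply (mk_unique _ _ _ (emp_set)). intros x.
    destruct (pn_mem glut_unit x) as [-> ->], (glut_unit_mem x). tauto.
Qed.

Lemma denotes_frak_n k e : denotes k e frak_n (Card gap_unit).
Proof.
  apply denotes_Card. eapply denotes_on3; [apply graph_mix3| | |].
  - replace (pb gap_unit) with (emp); [apply denotes_empty|].
    symmetry. apply (mk_unique _ _ _ (emp_set)). intros x.
    destruct (pb_mem gap_unit x) as [-> ->], (gap_unit_mem x). tauto.
  - replace (pt gap_unit) with (emp); [apply denotes_empty|].
    symmetry. apply (mk_unique _ _ _ (emp_set)). intros x.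
    destruct (pt_mem gap_unit x) as [-> ->], (gap_unit_mem x). tauto.
  - replace (pn gap_unit) with (sing (emp)); [apply denotes_sing_emp|].
    symmetry. apply (mk_unique _ _ _ (sing_set emp)). intros x.
    destruct (pn_mem gap_unit x) as [-> ->], (gap_unit_mem x). tauto.
Qed.

Lemma denotes_decomposition k e i : i < k ->
  denotes k e
    (on2 cadd
       (on2 cadd
          (on1 card (part_t i))
          (on2 cmul (on1 card (part_b i)) frak_b))
       (on2 cmul (on1 card (part_n i)) frak_n))%bs4
    (Card (e i)).
Proof.
  intros Hi. rewrite (Iso_Card _ _ (Iso_decomposition (e i))).
  assert (G : forall f X, graph1 f (e i) X -> denotes k e (f i) X)
    by (intros f X G; now apply (denotes_graph1 f (e i))).
  eapply denotes_on2; [apply graph_cadd| |].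
  - eapply denotes_on2; [apply graph_cadd| |].
    + apply denotes_Card, G, graph_part_t.
    + eapply denotes_on2; [apply graph_cmul| |apply denotes_frak_b].
      apply denotes_Card, G, graph_part_b.
  - eapply denotes_on2; [apply graph_cmul| |apply denotes_frak_n].
    apply denotes_Card, G, graph_part_n.
Qed.

End Universe.

Open Scope bs4_scope.

Theorem theorem5p9 :
  entails BZFC
    (sentence
       (∀ A,
          tEq (card A)
              (on2 cadd
                 (on2 cadd
                    (on1 card (part_t A))
                    (on2 cmul (on1 card (part_b A)) frak_b))
                 (on2 cmul (on1 card (part_n A)) frak_n)))).
Proof.
  intros M HM e.
  (* Both sides denote [Card M A], so each instance becomes [Card M A = Card M A] and its truth
     condition may be taken to be [True]. *)
  apply (tr_all M e 0 _ (fun _ => True)); [|trivial]. intros A.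
  rewrite (tr_tEq M 1 (upd e 0 A) _ _ (Card M A) (Card M A)).
  - tauto.
  - apply (denotes_graph1 M _ A); [apply (graph_card M HM)|lia|reflexivity].
  - apply (denotes_decomposition M HM 1 (upd e 0 A) 0). lia.
Qed.
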